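(* Let $\operatorname{Re}(a)>0$ and let $b$ be a complex number that is not a non-positive integer. Then, for a branch of the logarithm analytic near $\frac{1}{\Gamma(b)}$, the Taylor series of $\log E_{a,b}(z)$ around $z=0$ is $$\log E_{a,b}(z)=c_0+\sum_{m=1}^{\infty}c_m z^{m},\qquad c_0=\log\frac{1}{\Gamma(b)},$$ where for $m\ge 1$ $$c_m=-\sum_{k=1}^{m}\frac{(-\Gamma(b))^{k}}{k}\sum_{\substack{j_1+\cdots+j_k=m\\ j_i>0}}\ \prod_{i=1}^{k}\frac{1}{\Gamma(b+j_i a)} .$$
   Context: The Mittag-Leffler function is $E_{a,b}(z)=\sum_{k=0}^{\infty}\frac{z^{k}}{\Gamma(b+ak)}$, with $1/\Gamma$ the entire reciprocal Gamma function. The inner sum runs over all $k$-tuples $(j_1,\dots,j_k)$ of positive integers with sum $m$. *)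

(* Defs.v *)
From Stdlib Require Import Reals List FinFun Arith Lia.
From Coquelicot Require Import Coquelicot.
Import ListNotations.

Local Open Scope C_scope.

Definition Csum {A : Type} (s : list A) (f : A -> C) : C :=
  fold_right Cplus 0 (map f s).

Definition Cprod {A : Type} (s : list A) (f : A -> C) : C :=
  fold_right Cmult 1 (map f s).

(* Total, componentwise limit and sum: they carry meaning only for convergent
   arguments. *)
Definition Clim_seq (u : nat -> C) : C :=
  (real (Lim_seq (fun n => Re (u n))), real (Lim_seq (fun n => Im (u n)))).

Definition CSeries (u : nat -> C) : C :=
  (Series (fun n => Re (u n)), Series (fun n => Im (u n))).

Definition Cexp (z : C) : C :=
  ((exp (Re z) * cos (Im z))%R, (exp (Re z) * sin (Im z))%R).

(* Gauss's formula, valid for every complex z: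
     1/Gamma(z) = lim_n z (z + 1) ... (z + n) / (n! n^z),
   where n^z = exp (z ln n). *)
Definition rGamma (z : C) : C :=
  Clim_seq (fun n : nat =>
    Cprod (seq 0 (S n)) (fun k => z + INR k)
      / (INR (fact n) * Cexp (z * ln (INR n)))).

(* Meaningful away from the poles, i.e. when rGamma z <> 0. *)
Definition CGamma (z : C) : C := / rGamma z.

Definition mittag_leffler (a b z : C) : C :=
  CSeries (fun k : nat => z ^ k * rGamma (b + a * INR k)).

Fixpoint lists_of_length {A : Type} (k : nat) (s : list A) : list (list A) :=
  match k with
  | O => [[]]
  | S k' => flat_map (fun x => map (cons x) (lists_of_length k' s)) s
  end.

(* All k-tuples of positive integers with sum m, each listed once: see
   compositions_spec and compositions_NoDup. *)
Definition compositions (k m : nat) : list (list nat) :=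
  filter (fun js => Nat.eqb (list_sum js) m) (lists_of_length k (seq 1 m)).

Lemma in_lists_of_length {A : Type} (s : list A) (k : nat) (l : list A) :
  In l (lists_of_length k s) <-> length l = k /\ List.Forall (fun x => In x s) l.
Proof.
revert l; induction k as [|k IH]; intros l; simpl.
- split.
  + intros [<- | []]; auto.
  + intros [H _]; destruct l; [auto | discriminate].
- rewrite in_flat_map; split.
  + intros [x [Hx H]]; apply in_map_iff in H as [l' [<- H]].
    apply IH in H as [H1 H2]; simpl; auto.
  + destruct l as [|x l]; simpl; intros [H1 H2]; [discriminate|].
    inversion H2; subst; exists x; split; auto.
    apply in_map, IH; auto.
Qed.

Lemma lists_of_length_NoDup {A : Type} (s : list A) (k : nat) :
  NoDup s -> NoDup (lists_of_length k s).
Proof.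
intros Hs; induction k as [|k IH]; simpl.
- constructor; [intros [] | constructor].
- generalize Hs; generalize s at 1 3; intros t Ht.
  induction Ht as [|x t Hx Ht IHt]; simpl; [constructor|].
  apply NoDup_app; auto.
  + apply FinFun.Injective_map_NoDup; auto.
    intros u v H; now injection H.
  + intros l Hl Hl'; apply in_map_iff in Hl as [u [<- _]].
    apply in_flat_map in Hl' as [y [Hy H]].
    apply in_map_iff in H as [v [H _]]; injection H; intros; subst; auto.
Qed.

Lemma compositions_spec (k m : nat) (js : list nat) :
  In js (compositions k m) <->
  length js = k /\ List.Forall (fun j => 0 < j)%nat js /\ list_sum js = m.
Proof.
unfold compositions; rewrite filter_In, in_lists_of_length, Nat.eqb_eq.
rewrite !Forall_forall; split.
- intros [[H1 H2] H3]; repeat split; auto.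
  intros j Hj; apply H2, in_seq in Hj; lia.
- intros [H1 [H2 H3]]; repeat split; auto.
  intros j Hj; apply in_seq; specialize (H2 j Hj).
  cut (j <= m)%nat; [lia|]; subst m; clear - Hj.
  induction js as [|i js IH]; [destruct Hj|].
  destruct Hj as [-> | Hj]; simpl; [|specialize (IH Hj)]; lia.
Qed.

Lemma compositions_NoDup (k m : nat) : NoDup (compositions k m).
Proof. apply NoDup_filter, lists_of_length_NoDup, seq_NoDup. Qed.

Definition log_ML_coef (a b : C) (m : nat) : C :=
  - Csum (seq 1 m) (fun k =>
      (- CGamma b) ^ k / INR k *
      Csum (compositions k m) (fun js =>
        Cprod js (fun j => rGamma (b + INR j * a)))).

Definition C_ex_derive (f : C -> C) (z : C) : Prop :=
  @ex_derive C_AbsRing C_NormedModule f z.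

(* Only the values of L near w0 are constrained; holomorphy near w0 amounts to
   complex differentiability at every point of a neighbourhood. *)
Definition is_log_branch_near (L : C -> C) (w0 : C) : Prop :=
  locally w0 (fun w => C_ex_derive L w /\ Cexp (L w) = w).

Fixpoint C_derive_n (f : C -> C) (n : nat) : C -> C :=
  match n with
  | O => f
  | S n' => C_derive (C_derive_n f n')
  end.

(* f is infinitely complex differentiable near z0, c lists its Taylor
   coefficients at z0, and the series converges to f near z0.  The first
   conjunct matters because C_derive is a total function. *)
Definition is_Taylor_series (f : C -> C) (z0 : C) (c : nat -> C) : Prop :=
  (forall n, locally z0 (fun z => C_ex_derive (C_derive_n f n) z)) /\
  (forall n, c n = C_derive_n f n z0 / INR (fact n)) /\
  locally z0 (fun z => @is_pseries C_AbsRing C_NormedModule c (z - z0) (f z)).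

(* Main.v *)
Require Import Defs.
From Stdlib Require Import Reals List Arith Lra Lia Psatz.
From Coquelicot Require Import Coquelicot.
Import ListNotations.

Local Open Scope C_scope.

(** Let u(n) = 1/Gamma(b + an), so that E(z) = sum u(n) z^n, and let c be the
    proposed Taylor coefficients.

    The coefficients u(n) grow at most exponentially
    ([mittag_leffler_coef_geom_bounded]): for large n the points b + an lie in
    a sector around the positive real axis, where every term of Gauss's product
    is at most exponential in Re z ([rGamma_sector_bound]).  Hence E is the sum
    of a power series with positive radius of convergence.

    With h(z) = E(z) - u(0), the inner sum over compositions is the coefficient
    of z^m in h^k ([Csum_compositions]), so c is the formal logarithm
    L(u(0)) + sum_k (-1)^(k-1) (h/u(0))^k / k.  Differentiating it formally
    produces a geometric series, which gives the identity c' E = E' between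
    coefficient sequences ([cauchy_euler_log_coef]).  That identity serves
    twice.  Read as a recursion, it bounds c exponentially, since quotients of
    power series have positive radius of convergence
    ([geom_bounded_cauchy_quotient]).  Read between sums, it says that
    sum c(m) z^m has derivative E'/E near 0.

    On the other side, differentiating exp (L w) = w gives L'(w) = 1/w
    ([log_branch_diff]), so L(E(z)) also has derivative E'/E.  Both functions
    are equal to L(u(0)) at 0, hence they coincide on a disc
    ([log_power_series]); and the sum of a power series has that series as its
    Taylor series ([is_Taylor_series_power_series]). *)

(** * Exponential growth of the Mittag-Leffler coefficients *)

Lemma Cprod_snoc {A : Type} (s : list A) (x : A) (f : A -> C) :
  Cprod (s ++ [x]) f = Cprod s f * f x.
Proof.
  unfold Cprod; induction s as [|y s IH]; simpl in *; [ring|].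
  rewrite IH; ring.
Qed.

Lemma Cmod_Re_Im_sqr (z : C) : (Cmod z * Cmod z = Re z * Re z + Im z * Im z)%R.
Proof.
  replace (Cmod z * Cmod z)%R with (Cmod z ^ 2)%R by ring.
  rewrite Cmod2_alt; ring.
Qed.

Lemma Cmod_le_Re_Im (z : C) : (Cmod z <= Rabs (Re z) + Rabs (Im z))%R.
Proof.
  assert (H := Cmod_Re_Im_sqr z); assert (H0 := Cmod_ge_0 z).
  assert (H1 := Rabs_pos (Re z)); assert (H2 := Rabs_pos (Im z)).
  assert (H3 := Rsqr_abs (Re z)); assert (H4 := Rsqr_abs (Im z)).
  unfold Rsqr in *; nra.
Qed.

Lemma Cmod_Cexp (z : C) : Cmod (Cexp z) = exp (Re z).
Proof.
  apply Rsqr_inj; [apply Cmod_ge_0|left; apply exp_pos|].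
  unfold Rsqr; rewrite Cmod_Re_Im_sqr; simpl.
  assert (H := sin2_cos2 (Im z)); unfold Rsqr in H.
  transitivity (exp (Re z) * exp (Re z)
    * (sin (Im z) * sin (Im z) + cos (Im z) * cos (Im z)))%R; [ring|].
  rewrite H; ring.
Qed.

Lemma exp_nondecreasing (x y : R) : (x <= y)%R -> (exp x <= exp y)%R.
Proof.
  intros [H | ->]; [left; apply exp_increasing; exact H|right; reflexivity].
Qed.

Lemma inv_S_le_ln (n : nat) : (0 < n)%nat ->
  (/ INR (S n) <= ln (INR (S n)) - ln (INR n))%R.
Proof.
  intros Hn; apply lt_0_INR in Hn; rewrite S_INR.
  rewrite <- ln_div by lra.
  rewrite <- (ln_exp (/ (INR n + 1))).
  apply ln_le; [apply exp_pos|].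
  (* exp (-t) >= 1 - t at t = 1/(n+1), inverted *)
  assert (H := exp_ineq1_le (- / (INR n + 1))).
  rewrite exp_Ropp in H.
  assert (H1 := exp_pos (/ (INR n + 1))).
  replace (1 + - / (INR n + 1))%R with (/ ((INR n + 1) / INR n))%R in H
    by (field; lra).
  apply Rinv_le_contravar in H.
  - rewrite !Rinv_inv in H; exact H.
  - apply Rinv_0_lt_compat, Rdiv_lt_0_compat; lra.
Qed.

(** With z = x + iy and p = m + 1, the modulus is (x+p) sqrt(1 + y^2/(x+p)^2).
    The first factor is at most p exp(x/p); the logarithm of the second is at
    most half of K^2 x^2/(x+p)^2, and 1/(x+p)^2 is dominated by a telescoping
    difference. *)
Lemma Cmod_gauss_factor (z : C) (K : R) (m : nat) :
  (0 < Re z)%R -> (Rabs (Im z) <= K * Re z)%R ->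
  (Cmod (z + INR (S m)) <= INR (S m) * exp (Re z / INR (S m)
     + K * K * Re z * Re z / 2 * (/ (Re z + INR m) - / (Re z + INR (S m)))))%R.
Proof.
  intros Hx HK.
  set (x := Re z) in *; set (y := Im z) in *.
  assert (Hm : (0 <= INR m)%R) by apply pos_INR.
  rewrite !S_INR; set (p := INR m) in *.
  assert (Hy : (y * y <= K * K * x * x)%R).
  { assert (H := Rsqr_abs y); assert (H0 := Rabs_pos y); unfold Rsqr in H; nra. }
  assert (HS : (0 <= K * K * x * x)%R).
  { replace (K * K * x * x)%R with ((K * x) * (K * x))%R by ring. apply Rle_0_sqr. }
  apply Rsqr_incr_0_var.
  2: { apply Rmult_le_pos; [lra|left; apply exp_pos]. }
  unfold Rsqr; rewrite Cmod_Re_Im_sqr.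
  replace (Re (z + RtoC (p + 1))) with (x + (p + 1))%R
    by (rewrite re_plus, re_RtoC; reflexivity).
  replace (Im (z + RtoC (p + 1))) with y
    by (rewrite im_plus, im_RtoC; unfold y; ring).
  set (q := (x + (p + 1))%R).
  set (D := (/ (x + p) - / q)%R).
  assert (HD : (/ (q * q) <= D)%R).
  { unfold D, q.
    replace (/ (x + p) - / (x + (p + 1)))%R
      with (/ ((x + p) * (x + (p + 1))))%R by (field; lra).
    apply Rinv_le_contravar; nra. }
  set (e1 := exp (x / (p + 1))).
  assert (H1 : (q <= (p + 1) * e1)%R).
  { assert (H := exp_ineq1_le (x / (p + 1))); fold e1 in H.
    apply Rle_trans with ((p + 1) * (1 + x / (p + 1)))%R.
    - unfold q; right; field; lra.
    - apply Rmult_le_compat_l; lra. }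
  rewrite exp_plus; fold e1.
  set (e2 := exp (K * K * x * x / 2 * D)).
  assert (H2 : (1 + K * K * x * x / (q * q) <= e2 * e2)%R).
  { unfold e2; rewrite <- exp_plus.
    apply Rle_trans with (1 + K * K * x * x * D)%R.
    - apply Rplus_le_compat_l; unfold Rdiv; apply Rmult_le_compat_l; [exact HS|exact HD].
    - eapply Rle_trans; [apply exp_ineq1_le|]; right; f_equal; field. }
  assert (Hq : (0 < q)%R) by (unfold q; lra).
  apply Rle_trans with (q * q * (1 + K * K * x * x / (q * q)))%R.
  - replace (q * q * (1 + K * K * x * x / (q * q)))%R
      with (q * q + K * K * x * x)%R by (field; lra). lra.
  - replace ((p + 1) * (e1 * e2) * ((p + 1) * (e1 * e2)))%R
      with (((p + 1) * e1) * ((p + 1) * e1) * (e2 * e2))%R by ring.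
    assert (H3 : (0 <= K * K * x * x / (q * q))%R)
      by (apply Rdiv_le_0_compat; [exact HS|nra]).
    apply Rmult_le_compat; [nra|lra| |exact H2].
    apply Rmult_le_compat; lra.
Qed.

Lemma Cmod_gauss_prod (z : C) (K : R) (n : nat) :
  (0 < Re z)%R -> (Rabs (Im z) <= K * Re z)%R -> (0 < n)%nat ->
  (Cmod (Cprod (seq 0 (S n)) (fun k => (z + INR k)%C))
   <= Cmod z * INR (fact n) * exp (Re z * (1 + ln (INR n))
        + K * K * Re z * Re z / 2 * (/ Re z - / (Re z + INR n))))%R.
Proof.
  intros Hx HK Hn.
  induction n as [|n IH]; [lia|].
  rewrite seq_S, Cprod_snoc, Cmod_mult; cbn [Nat.add].
  assert (Hf := Cmod_gauss_factor z K n Hx HK).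
  destruct n as [|n].
  - replace (Cprod (seq 0 1) (fun k => (z + INR k)%C)) with z
      by (unfold Cprod; simpl; ring).
    rewrite Rmult_assoc; apply Rmult_le_compat_l; [apply Cmod_ge_0|].
    eapply Rle_trans; [exact Hf|]; right.
    rewrite INR_1, ln_1; simpl INR.
    f_equal; f_equal; rewrite Rplus_0_r; unfold Rdiv; rewrite Rinv_1; ring.
  - specialize (IH ltac:(lia)).
    eapply Rle_trans.
    { apply Rmult_le_compat; [apply Cmod_ge_0|apply Cmod_ge_0|exact IH|exact Hf]. }
    set (n' := S n) in *.
    rewrite fact_simpl, mult_INR.
    set (E1 := exp _); set (E2 := exp _) at 1; set (E3 := exp _).
    replace (Cmod z * INR (fact n') * E1 * (INR (S n') * E2))%R
      with (Cmod z * (INR (S n') * INR (fact n')) * (E1 * E2))%R by ring.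
    apply Rmult_le_compat_l.
    { apply Rmult_le_pos; [apply Cmod_ge_0|]; apply Rmult_le_pos; apply pos_INR. }
    unfold E1, E2, E3; rewrite <- exp_plus; apply exp_nondecreasing.
    assert (Hl := inv_S_le_ln n' ltac:(unfold n'; lia)).
    assert (Re z / INR (S n') <= Re z * (ln (INR (S n')) - ln (INR n')))%R
      by (apply Rmult_le_compat_l; lra).
    lra.
Qed.

Lemma real_Lim_seq_bound (u : nat -> R) (B : R) :
  (forall n, (0 < n)%nat -> (Rabs (u n) <= B)%R) -> (Rabs (Lim_seq u) <= B)%R.
Proof.
  intros H.
  assert (H1 : Rbar_le (Lim_seq u) B).
  { rewrite <- (Lim_seq_const B); apply Lim_seq_le_loc.
    exists 1%nat; intros n Hn; specialize (H n ltac:(lia)).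
    apply Rabs_le_between in H; lra. }
  assert (H2 : Rbar_le (- B)%R (Lim_seq u)).
  { rewrite <- (Lim_seq_const (- B)); apply Lim_seq_le_loc.
    exists 1%nat; intros n Hn; specialize (H n ltac:(lia)).
    apply Rabs_le_between in H; lra. }
  destruct (Lim_seq u); simpl in *; try contradiction.
  apply Rabs_le; lra.
Qed.

(** Dividing the product bound by n! n^z removes the factor n! exp(x ln n),
    and |z| <= (1+K) x <= (1+K) exp x.  The bound is uniform in n, so it passes
    to the limit; the factor 2 comes from recombining the real and imaginary
    parts, whose limits are taken separately. *)
Lemma rGamma_sector_bound (z : C) (K : R) :
  (0 < Re z)%R -> (Rabs (Im z) <= K * Re z)%R ->
  (Cmod (rGamma z) <= 2 * (1 + K) * exp ((2 + K * K) * Re z))%R.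
Proof.
  intros Hx HK.
  assert (HK0 : (0 <= K)%R).
  { assert (H := Rabs_pos (Im z)); nra. }
  set (B := ((1 + K) * exp ((2 + K * K) * Re z))%R).
  assert (HB : forall n, (0 < n)%nat ->
    (Cmod (Cprod (seq 0 (S n)) (fun k => (z + INR k)%C)
      / (INR (fact n) * Cexp (z * ln (INR n)))) <= B)%R).
  { intros n Hn.
    assert (Hf : (0 < INR (fact n))%R) by apply INR_fact_lt_0.
    assert (HE := exp_pos (Re z * ln (INR n))).
    assert (Hm : Cmod (INR (fact n) * Cexp (z * ln (INR n)))
                 = (INR (fact n) * exp (Re z * ln (INR n)))%R).
    { rewrite Cmod_mult, Cmod_R, Cmod_Cexp, re_scal_r, Rabs_pos_eq; lra. }
    rewrite Cmod_div.
    2: { apply Cmod_gt_0; rewrite Hm; apply Rmult_lt_0_compat; lra. }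
    rewrite Hm.
    apply Rle_div_l; [apply Rmult_lt_0_compat; lra|].
    eapply Rle_trans; [apply (Cmod_gauss_prod z K n Hx HK Hn)|].
    set (T := (K * K * Re z * Re z / 2 * (/ Re z - / (Re z + INR n)))%R).
    assert (HT : (T <= K * K * Re z)%R).
    { assert (0 < / (Re z + INR n))%R.
      { apply Rinv_0_lt_compat; assert (H := pos_INR n); lra. }
      assert (0 <= K * K * Re z * Re z / 2)%R by nra.
      assert (T <= K * K * Re z * Re z / 2 * / Re z)%R.
      { unfold T; apply Rmult_le_compat_l; lra. }
      replace (K * K * Re z * Re z / 2 * / Re z)%R with (K * K * Re z / 2)%R in H1
        by (field; lra).
      nra. }
    assert (Hz : (Cmod z <= (1 + K) * exp (Re z))%R).
    { eapply Rle_trans; [apply Cmod_le_Re_Im|].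
      rewrite (Rabs_pos_eq (Re z)) by lra.
      assert (H := exp_ineq1_le (Re z)); nra. }
    apply Rle_trans with ((1 + K) * exp (Re z) * INR (fact n)
      * exp (Re z * (1 + ln (INR n)) + K * K * Re z))%R.
    - apply Rmult_le_compat.
      + apply Rmult_le_pos; [apply Cmod_ge_0|lra].
      + left; apply exp_pos.
      + apply Rmult_le_compat_r; lra.
      + apply exp_nondecreasing; lra.
    - right; unfold B.
      replace ((2 + K * K) * Re z)%R with (Re z + (Re z + K * K * Re z))%R by ring.
      replace (Re z * (1 + ln (INR n)) + K * K * Re z)%R
        with (Re z * ln (INR n) + (Re z + K * K * Re z))%R by ring.
      rewrite !exp_plus; ring. }
  unfold rGamma, Clim_seq.
  eapply Rle_trans; [apply Cmod_le_Re_Im|]; cbn [Re Im fst snd].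
  replace (2 * (1 + K) * exp ((2 + K * K) * Re z))%R with (B + B)%R
    by (unfold B; ring).
  apply Rplus_le_compat; apply real_Lim_seq_bound; intros n Hn;
    (eapply Rle_trans; [|apply (HB n Hn)]).
  - apply re_le_Cmod.
  - eapply Rle_trans; [apply Rmax_r|apply Rmax_Cmod].
Qed.

(** Equivalent to a positive radius of convergence.  Requiring 1 <= r makes
    r^n nondecreasing in n. *)
Definition geom_bounded (u : nat -> C) : Prop :=
  exists M r : R, (1 <= r)%R /\ forall n, (Cmod (u n) <= M * r ^ n)%R.

Lemma geom_bounded_eventually (u : nat -> C) (N : nat) (M r : R) :
  (1 <= r)%R -> (forall n, (N <= n)%nat -> (Cmod (u n) <= M * r ^ n)%R) ->
  geom_bounded u.
Proof.
  intros Hr; induction N as [|N IH] in M |- *; intros H.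
  - exists M, r; split; [exact Hr|]; intros n; apply H; lia.
  - apply (IH (Rmax M (Cmod (u N)))); intros n Hn.
    assert (H1 : (1 <= r ^ n)%R) by (apply pow_R1_Rle; exact Hr).
    destruct (Nat.eq_dec n N) as [-> | Hne].
    + assert (H2 := Rmax_r M (Cmod (u N))); assert (H3 := Cmod_ge_0 (u N)); nra.
    + eapply Rle_trans; [apply H; lia|].
      apply Rmult_le_compat_r; [lra|apply Rmax_l].
Qed.

Lemma exp_INR_mult (c : R) (n : nat) : exp (c * INR n) = (exp c ^ n)%R.
Proof.
  induction n as [|n IH]; [simpl; rewrite Rmult_0_r; apply exp_0|].
  rewrite S_INR, Rmult_plus_distr_l, exp_plus, IH, Rmult_1_r; simpl; ring.
Qed.

(** Since Re a > 0, the points b + an eventually stay in a sector around the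
    positive real axis, where the sector bound is exponential in n. *)
Lemma mittag_leffler_coef_geom_bounded (a b : C) :
  (0 < Re a)%R -> geom_bounded (fun n => rGamma (b + a * INR n)).
Proof.
  intros Ha.
  set (A := Re a) in *.
  set (K := (2 * (Rabs (Im a) + Rabs (Im b)) / A)%R).
  (* From N on, |Re b| is at most half of n Re a, so Re (b + an) >= n Re a / 2. *)
  destruct (archimed_cor1 (A / (2 * Rabs (Re b) + 1))%R) as [N [HN HN0]].
  { apply Rdiv_lt_0_compat; [exact Ha|]. assert (H := Rabs_pos (Re b)); lra. }
  set (c := ((2 + K * K) * (Rabs (Re b) + A))%R).
  assert (Hc : (0 <= c)%R).
  { unfold c; assert (H := Rabs_pos (Re b)); apply Rmult_le_pos; nra. }
  apply (geom_bounded_eventually _ N (2 * (1 + K)) (exp c)).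
  { rewrite <- exp_0; apply exp_nondecreasing; exact Hc. }
  intros n Hn.
  assert (HNn : (1 <= INR N <= INR n)%R).
  { split; [apply (le_INR 1); lia|apply le_INR; exact Hn]. }
  assert (Hb : (2 * Rabs (Re b) <= A * INR n)%R).
  { apply Rmult_lt_compat_r with (r := (INR N * (2 * Rabs (Re b) + 1))%R) in HN.
    2: { assert (H := Rabs_pos (Re b)); nra. }
    replace (/ INR N * (INR N * (2 * Rabs (Re b) + 1)))%R
      with (2 * Rabs (Re b) + 1)%R in HN by (field; lra).
    replace (A / (2 * Rabs (Re b) + 1) * (INR N * (2 * Rabs (Re b) + 1)))%R
      with (A * INR N)%R in HN
      by (field; assert (H := Rabs_pos (Re b)); lra).
    nra. }
  set (z := b + a * INR n).
  assert (HRe : Re z = (Re b + A * INR n)%R)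
    by (unfold z; rewrite re_plus, re_scal_r; reflexivity).
  assert (HIm : Im z = (Im b + Im a * INR n)%R)
    by (unfold z; rewrite im_plus, im_scal_r; reflexivity).
  assert (Hb1 : (- Rabs (Re b) <= Re b <= Rabs (Re b))%R)
    by (apply Rabs_le_between; lra).
  assert (Hlow : (A * INR n / 2 <= Re z)%R) by lra.
  assert (Hpos : (0 < Re z)%R) by nra.
  assert (HKz : (Rabs (Im z) <= K * Re z)%R).
  { apply Rle_trans with (K * (A * INR n / 2))%R.
    - replace (K * (A * INR n / 2))%R
        with ((Rabs (Im a) + Rabs (Im b)) * INR n)%R by (unfold K; field; lra).
      rewrite HIm; eapply Rle_trans; [apply Rabs_triang|].
      rewrite Rabs_mult, (Rabs_pos_eq (INR n)) by lra.
      assert (H := Rabs_pos (Im b)); nra.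
    - apply Rmult_le_compat_l; [|exact Hlow].
      unfold K; apply Rdiv_le_0_compat; [|exact Ha].
      assert (H := Rabs_pos (Im a)); assert (H0 := Rabs_pos (Im b)); lra. }
  eapply Rle_trans; [apply (rGamma_sector_bound z K Hpos HKz)|].
  assert (HK0 : (0 <= K)%R).
  { unfold K; apply Rdiv_le_0_compat; [|exact Ha].
    assert (H := Rabs_pos (Im a)); assert (H0 := Rabs_pos (Im b)); lra. }
  apply Rmult_le_compat_l; [lra|].
  rewrite <- exp_INR_mult; apply exp_nondecreasing.
  unfold c; rewrite Rmult_assoc; apply Rmult_le_compat_l; [nra|].
  rewrite HRe; assert (H := Rabs_pos (Re b)); nra.
Qed.

(** * Finite sums and Cauchy products of coefficient sequences *)

Lemma Csum_ext {A : Type} (s : list A) (f g : A -> C) :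
  (forall x, In x s -> f x = g x) -> Csum s f = Csum s g.
Proof.
  unfold Csum; induction s as [|x s IH]; simpl; intros H; [reflexivity|].
  rewrite (H x) by (left; reflexivity); rewrite IH; [reflexivity|].
  intros y Hy; apply H; right; exact Hy.
Qed.

Lemma Csum_cons {A : Type} (x : A) (s : list A) (f : A -> C) :
  Csum (x :: s) f = f x + Csum s f.
Proof. reflexivity. Qed.

Lemma Csum_app {A : Type} (s t : list A) (f : A -> C) :
  Csum (s ++ t) f = Csum s f + Csum t f.
Proof.
  induction s as [|x s IH]; simpl; rewrite ?Csum_cons, ?IH; [|ring].
  unfold Csum at 2; simpl; ring.
Qed.

Lemma Csum_snoc {A : Type} (s : list A) (x : A) (f : A -> C) :
  Csum (s ++ [x]) f = Csum s f + f x.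
Proof. rewrite Csum_app; unfold Csum at 2; simpl; ring. Qed.

Lemma Csum_0 {A : Type} (s : list A) (f : A -> C) :
  (forall x, In x s -> f x = 0) -> Csum s f = 0.
Proof.
  induction s as [|x s IH]; intros H; [reflexivity|].
  rewrite Csum_cons, (H x), IH; [ring| |left; reflexivity].
  intros y Hy; apply H; right; exact Hy.
Qed.

Lemma Csum_plus {A : Type} (s : list A) (f g : A -> C) :
  Csum s (fun x => f x + g x) = Csum s f + Csum s g.
Proof.
  induction s as [|x s IH]; rewrite ?Csum_cons, ?IH; [unfold Csum; simpl|]; ring.
Qed.

Lemma Csum_scal {A : Type} (s : list A) (c : C) (f : A -> C) :
  Csum s (fun x => c * f x) = c * Csum s f.
Proof.
  induction s as [|x s IH]; rewrite ?Csum_cons, ?IH; [unfold Csum; simpl|]; ring.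
Qed.

Lemma Csum_map {A B : Type} (g : A -> B) (s : list A) (f : B -> C) :
  Csum (map g s) f = Csum s (fun x => f (g x)).
Proof. unfold Csum; rewrite map_map; reflexivity. Qed.

Lemma Csum_flat_map {A B : Type} (g : A -> list B) (s : list A) (f : B -> C) :
  Csum (flat_map g s) f = Csum s (fun x => Csum (g x) f).
Proof.
  induction s as [|x s IH]; simpl; [reflexivity|].
  rewrite Csum_app, IH; reflexivity.
Qed.

Lemma Csum_filter {A : Type} (p : A -> bool) (s : list A) (f : A -> C) :
  Csum (filter p s) f = Csum s (fun x => if p x then f x else 0).
Proof.
  induction s as [|x s IH]; simpl; [reflexivity|].
  rewrite Csum_cons, <- IH; destruct (p x); [reflexivity|ring].
Qed.

Lemma Csum_seq_shift (m n : nat) (f : nat -> C) :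
  Csum (seq (S m) n) f = Csum (seq m n) (fun k => f (S k)).
Proof. rewrite <- seq_shift; apply Csum_map. Qed.

Definition cauchy_product (u v : nat -> C) (n : nat) : C :=
  Csum (seq 0 (S n)) (fun k => u k * v (n - k)%nat).

Definition shift (u : nat -> C) (n : nat) : C := u (S n).

Lemma cauchy_0 (u v : nat -> C) : cauchy_product u v 0 = u 0%nat * v 0%nat.
Proof. unfold cauchy_product, Csum; simpl; ring. Qed.

Lemma cauchy_S (u v : nat -> C) (n : nat) :
  cauchy_product u v (S n) = u 0%nat * v (S n) + cauchy_product (shift u) v n.
Proof.
  unfold cauchy_product; change (seq 0 (S (S n))) with (0%nat :: seq 1 (S n)).
  rewrite Csum_cons, Csum_seq_shift; reflexivity.
Qed.

Lemma cauchy_ext (u u' v v' : nat -> C) (n : nat) :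
  (forall k, (k <= n)%nat -> u k = u' k) ->
  (forall k, (k <= n)%nat -> v k = v' k) -> cauchy_product u v n = cauchy_product u' v' n.
Proof.
  intros Hu Hv; apply Csum_ext; intros k Hk; apply in_seq in Hk.
  rewrite Hu, Hv by lia; reflexivity.
Qed.

Lemma cauchy_plus_l (u u' v : nat -> C) (n : nat) :
  cauchy_product (fun k => u k + u' k) v n = cauchy_product u v n + cauchy_product u' v n.
Proof.
  unfold cauchy_product; rewrite <- Csum_plus; apply Csum_ext; intros; ring.
Qed.

Lemma cauchy_scal_l (c : C) (u v : nat -> C) (n : nat) :
  cauchy_product (fun k => c * u k) v n = c * cauchy_product u v n.
Proof.
  unfold cauchy_product; rewrite <- Csum_scal; apply Csum_ext; intros; ring.
Qed.

Lemma cauchy_S_r (u v : nat -> C) (n : nat) :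
  cauchy_product u v (S n) = u (S n) * v 0%nat + cauchy_product u (shift v) n.
Proof.
  revert u; induction n as [|n IH]; intros u.
  - rewrite cauchy_S, !cauchy_0; unfold shift; ring.
  - rewrite cauchy_S, IH, (cauchy_S u (shift v)); unfold shift; ring.
Qed.

Lemma cauchy_comm (u v : nat -> C) (n : nat) : cauchy_product u v n = cauchy_product v u n.
Proof.
  revert u; induction n as [|n IH]; intros u.
  - rewrite !cauchy_0; ring.
  - rewrite cauchy_S, cauchy_S_r, IH; ring.
Qed.

(** Dropping the constant term of u * v gives u(0) times the shift of v plus
    shift(u) * v, which turns associativity into an induction on the index. *)
Lemma cauchy_assoc (u v w : nat -> C) (n : nat) :
  cauchy_product (cauchy_product u v) w n = cauchy_product u (cauchy_product v w) n.
Proof.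
  revert u; induction n as [|n IH]; intros u.
  - rewrite !cauchy_0; ring.
  - rewrite !cauchy_S, <- IH, cauchy_0.
    rewrite (cauchy_ext (shift (cauchy_product u v))
      (fun k => u 0%nat * shift v k + cauchy_product (shift u) v k) w w);
      [|intros k _; unfold shift at 1; apply cauchy_S|reflexivity].
    rewrite cauchy_plus_l, cauchy_scal_l; ring.
Qed.

Lemma cauchy_Csum_r {A : Type} (s : list A) (c : A -> C) (u : nat -> C)
    (v : A -> nat -> C) (n : nat) :
  cauchy_product u (fun j => Csum s (fun k => c k * v k j)) n
  = Csum s (fun k => c k * cauchy_product u (v k) n).
Proof.
  induction s as [|x s IH].
  - apply Csum_0; intros k _; unfold Csum; simpl; ring.
  - rewrite Csum_cons, <- IH, (cauchy_comm u (v x)), <- cauchy_scal_l.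
    rewrite (cauchy_comm u _ n), (cauchy_comm u _ n), <- cauchy_plus_l.
    apply cauchy_ext; reflexivity.
Qed.

Definition cauchy_one (n : nat) : C := match n with O => 1 | S _ => 0 end.

Lemma cauchy_1_l (u : nat -> C) (n : nat) : cauchy_product cauchy_one u n = u n.
Proof.
  unfold cauchy_product; change (seq 0 (S n)) with (0%nat :: seq 1 n).
  rewrite Csum_cons, Csum_seq_shift, Csum_0; [|intros; simpl; ring].
  rewrite Nat.sub_0_r; simpl; ring.
Qed.

Fixpoint cauchy_power (u : nat -> C) (k : nat) : nat -> C :=
  match k with
  | O => cauchy_one
  | S k' => cauchy_product u (cauchy_power u k')
  end.

Lemma cauchy_power_small (u : nat -> C) (k n : nat) :
  u 0%nat = 0 -> (n < k)%nat -> cauchy_power u k n = 0.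
Proof.
  intros Hu; revert n; induction k as [|k IH]; intros n Hn; [lia|].
  simpl; apply Csum_0; intros j Hj; apply in_seq in Hj.
  destruct j as [|j]; [rewrite Hu; ring|].
  rewrite IH by lia; ring.
Qed.

(** The operator z d/dz; unlike d/dz it does not shift indices, so Leibniz'
    rule needs no boundary terms. *)
Definition euler (u : nat -> C) (n : nat) : C := INR n * u n.

Lemma euler_cauchy (u v : nat -> C) (n : nat) :
  euler (cauchy_product u v) n = cauchy_product (euler u) v n + cauchy_product u (euler v) n.
Proof.
  unfold euler at 1; unfold cauchy_product; rewrite <- Csum_scal, <- Csum_plus.
  apply Csum_ext; intros k Hk; apply in_seq in Hk; unfold euler.
  rewrite minus_INR, RtoC_minus by lia; ring.
Qed.

Lemma euler_cauchy_power (u : nat -> C) (k n : nat) :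
  euler (cauchy_power u (S k)) n
  = INR (S k) * cauchy_product (euler u) (cauchy_power u k) n.
Proof.
  revert n; induction k as [|k IH]; intros n.
  - change (cauchy_power u 1) with (cauchy_product u cauchy_one).
    rewrite euler_cauchy, Cplus_comm, (cauchy_comm u (euler cauchy_one)).
    rewrite (cauchy_ext (euler cauchy_one) (fun j => 0 * u j) u u).
    + rewrite cauchy_scal_l; simpl; ring.
    + intros [|j] _; unfold euler, cauchy_one; simpl; ring.
    + reflexivity.
  - change (cauchy_power u (S (S k))) with (cauchy_product u (cauchy_power u (S k))).
    rewrite euler_cauchy.
    rewrite (cauchy_ext u u (euler (cauchy_power u (S k)))
      (fun j => INR (S k) * cauchy_product (euler u) (cauchy_power u k) j) n);
      [|reflexivity|intros j _; apply IH].
    rewrite (cauchy_comm u), cauchy_scal_l, (cauchy_comm _ u), <- cauchy_assoc.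
    rewrite (cauchy_ext (cauchy_product u (euler u)) (cauchy_product (euler u) u)
      (cauchy_power u k) (cauchy_power u k));
      [|intros; apply cauchy_comm|reflexivity].
    rewrite cauchy_assoc.
    change (cauchy_product u (cauchy_power u k)) with (cauchy_power u (S k)).
    rewrite (S_INR (S k)), RtoC_plus; ring.
Qed.

(** * The logarithmic coefficients *)

Definition positive_part (u : nat -> C) (n : nat) : C :=
  match n with O => 0 | S _ => u n end.

(** Summing over the first entry of a composition is one Cauchy
    multiplication; the list of candidate entries may be longer than m,
    because an entry larger than the sum never survives the filter. *)
Lemma Csum_compositions (u : nat -> C) (M k m : nat) : (m <= M)%nat ->
  Csum (filter (fun js => Nat.eqb (list_sum js) m) (lists_of_length k (seq 1 M)))
    (fun js => Cprod js u) = cauchy_power (positive_part u) k m.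
Proof.
  revert m; induction k as [|k IH]; intros m Hm; simpl.
  - destruct m; unfold Csum, Cprod; simpl; ring.
  - rewrite Csum_filter, Csum_flat_map.
    replace M with (m + (M - m))%nat at 1 by lia.
    rewrite seq_app, Csum_app.
    rewrite (Csum_0 (seq (1 + m) (M - m))).
    + unfold cauchy_product; change (seq 0 (S m)) with (0%nat :: seq 1 m).
      rewrite Csum_cons; simpl (positive_part u 0).
      rewrite Cmult_0_l, Cplus_0_l, Cplus_0_r.
      apply Csum_ext; intros x Hx; apply in_seq in Hx.
      rewrite <- IH by lia.
      rewrite Csum_map, Csum_filter, <- Csum_scal.
      apply Csum_ext; intros l _.
      destruct x as [|x]; [lia|]; simpl positive_part.
      change (list_sum (S x :: l)) with (S x + list_sum l)%nat.
      destruct (Nat.eqb_spec (S x + list_sum l) m);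
        destruct (Nat.eqb_spec (list_sum l) (m - S x)); try lia;
        [reflexivity|ring].
    + intros x Hx; apply in_seq in Hx.
      rewrite Csum_map; apply Csum_0; intros l _.
      change (list_sum (x :: l)) with (x + list_sum l)%nat.
      destruct (Nat.eqb_spec (x + list_sum l) m); [lia|reflexivity].
Qed.

(** For m >= 1, the coefficient of z^m in log (1 + g h), where h is the part of
    the series u without constant term; g stands for 1/u(0). *)
Definition log_coef (g : C) (u : nat -> C) (m : nat) : C :=
  - Csum (seq 1 m) (fun k => (- g) ^ k / INR k * cauchy_power (positive_part u) k m).

Lemma log_ML_coef_eq (a b : C) (m : nat) :
  log_ML_coef a b m
  = log_coef (CGamma b) (fun n => rGamma (b + a * INR n)) m.
Proof.
  unfold log_ML_coef, log_coef; f_equal; apply Csum_ext; intros k _.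
  f_equal; rewrite <- (Csum_compositions _ m k m) by lia.
  apply Csum_ext; intros js _; unfold Cprod; f_equal; apply map_ext; intros j.
  f_equal; ring.
Qed.

(** The geometric series: with g u(0) = 1 and h = u - u(0), the truncation to
    N terms of g / (1 + g h) is a multiplicative inverse of u up to a
    multiple of h^N. *)
Lemma cauchy_geometric (g : C) (u : nat -> C) (N n : nat) :
  g * u 0%nat = 1 ->
  cauchy_product u (fun j => Csum (seq 0 N) (fun k =>
     - (- g) ^ S k * cauchy_power (positive_part u) k j)) n
  = cauchy_one n - (- g) ^ N * cauchy_power (positive_part u) N n.
Proof.
  intros Hg; rewrite cauchy_Csum_r.
  induction N as [|N IH]; [unfold Csum; simpl; ring|].
  rewrite seq_S, Csum_snoc, IH; cbn [Nat.add].
  set (h := positive_part u).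
  assert (H : cauchy_product u (cauchy_power h N) n
    = u 0%nat * cauchy_power h N n + cauchy_power h (S N) n).
  { transitivity (cauchy_product (fun k => u 0%nat * cauchy_one k + h k) (cauchy_power h N) n).
    - apply cauchy_ext; [|reflexivity].
      intros [|k] _; unfold h; simpl; ring.
    - rewrite cauchy_plus_l, cauchy_scal_l, cauchy_1_l; reflexivity. }
  rewrite H.
  replace (- (- g) ^ S N * (u 0%nat * cauchy_power h N n + cauchy_power h (S N) n))
    with ((- g) ^ N * (g * u 0%nat) * cauchy_power h N n
          - (- g) ^ S N * cauchy_power h (S N) n) by (simpl; ring).
  rewrite Hg; ring.
Qed.

Lemma INR_S_neq_0 (k : nat) : RtoC (INR (S k)) <> 0.
Proof. intros H; apply RtoC_inj in H; exact (not_0_INR (S k) ltac:(lia) H). Qed.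

(** The formal identity (log u)' u = u'.  Differentiating the k-th power
    cancels the factor 1/k, which leaves z h' times the geometric series of
    u^-1; up to index n, powers of h beyond the n-th do not contribute. *)
Lemma cauchy_euler_log_coef (g : C) (u : nat -> C) (n : nat) :
  g * u 0%nat = 1 -> cauchy_product (euler (log_coef g u)) u n = euler u n.
Proof.
  intros Hg.
  set (h := positive_part u).
  set (e := fun j => Csum (seq 0 (S n)) (fun k =>
              - (- g) ^ S k * cauchy_power h k j)).
  assert (HT : forall j, euler h j = euler u j).
  { intros [|j]; unfold euler, h; simpl; ring. }
  assert (Hlog : forall j, (j <= n)%nat ->
            euler (log_coef g u) j = cauchy_product (euler h) e j).
  { intros j Hj; unfold e; rewrite cauchy_Csum_r.
    replace (S n) with (j + (S n - j))%nat by lia.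
    rewrite seq_app, Csum_app, (Csum_0 (seq (0 + j) (S n - j))).
    - unfold euler at 1; unfold log_coef; fold h.
      replace (INR j * - Csum (seq 1 j) (fun k => (- g) ^ k / INR k * cauchy_power h k j))
        with (- INR j * Csum (seq 1 j) (fun k => (- g) ^ k / INR k * cauchy_power h k j))
        by ring.
      rewrite Cplus_0_r, <- Csum_scal, Csum_seq_shift; apply Csum_ext; intros k _.
      assert (HE := euler_cauchy_power h k j); unfold euler at 1 in HE.
      assert (Hk := INR_S_neq_0 k).
      replace (- INR j * ((- g) ^ S k / INR (S k) * cauchy_power h (S k) j))
        with (- (- g) ^ S k / INR (S k) * (INR j * cauchy_power h (S k) j))
        by (field; exact Hk).
      rewrite HE; field; exact Hk.
    - intros k Hk; apply in_seq in Hk.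
      assert (HE := euler_cauchy_power h k j); unfold euler at 1 in HE.
      rewrite cauchy_power_small in HE by (reflexivity || lia).
      replace (cauchy_product (euler h) (cauchy_power h k) j) with (RtoC 0); [ring|].
      replace (cauchy_product (euler h) (cauchy_power h k) j) with
        (INR (S k) * cauchy_product (euler h) (cauchy_power h k) j / INR (S k))
        by (field; apply INR_S_neq_0).
      rewrite <- HE; field; apply INR_S_neq_0. }
  rewrite (cauchy_ext _ (cauchy_product (euler h) e) u u n Hlog) by reflexivity.
  rewrite cauchy_assoc.
  rewrite (cauchy_ext (euler h) (euler h) _ cauchy_one); [|reflexivity|].
  - rewrite cauchy_comm, cauchy_1_l; apply HT.
  - intros j Hj; rewrite cauchy_comm; unfold e.
    rewrite cauchy_geometric by exact Hg.
    rewrite (cauchy_power_small _ (S n)) by (reflexivity || lia); ring.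
Qed.

(** * Complex power series near the origin *)

(** Componentwise convergence, so that everything reduces to real series. *)
Definition C_sums (u : nat -> C) (l : C) : Prop :=
  is_series (fun n => Re (u n)) (Re l) /\ is_series (fun n => Im (u n)) (Im l).

Lemma Im_le_Cmod (z : C) : (Rabs (Im z) <= Cmod z)%R.
Proof. eapply Rle_trans; [apply Rmax_r|apply Rmax_Cmod]. Qed.

Lemma C_sums_unique (u : nat -> C) (l : C) : C_sums u l -> CSeries u = l.
Proof.
  intros [H1 H2]; unfold CSeries.
  rewrite (is_series_unique _ _ H1), (is_series_unique _ _ H2).
  destruct l; reflexivity.
Qed.

Lemma C_sums_ext (u v : nat -> C) (l : C) :
  (forall n, u n = v n) -> C_sums u l -> C_sums v l.
Proof.
  intros H [H1 H2]; split; [eapply is_series_ext; [|exact H1]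
    |eapply is_series_ext; [|exact H2]]; intros n; simpl; rewrite H; reflexivity.
Qed.

Lemma C_sums_minus (u v : nat -> C) (l m : C) :
  C_sums u l -> C_sums v m -> C_sums (fun n => u n - v n) (l - m).
Proof.
  intros [H1 H2] [H3 H4]; split.
  - exact (is_series_minus _ _ _ _ H1 H3).
  - exact (is_series_minus _ _ _ _ H2 H4).
Qed.

Lemma C_sums_scal (c : C) (u : nat -> C) (l : C) :
  C_sums u l -> C_sums (fun n => c * u n) (c * l).
Proof.
  intros [H1 H2]; split.
  - exact (is_series_minus _ _ _ _
      (is_series_scal_l (Re c) _ _ H1) (is_series_scal_l (Im c) _ _ H2)).
  - exact (is_series_plus _ _ _ _
      (is_series_scal_l (Re c) _ _ H2) (is_series_scal_l (Im c) _ _ H1)).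
Qed.

Lemma C_sums_tail (u : nat -> C) (l : C) :
  C_sums u l -> C_sums (fun n => u (S n)) (l - u 0%nat).
Proof.
  intros [H1 H2]; split.
  - apply (is_series_incr_1 (fun n => Re (u n))).
    eapply eq_ind; [exact H1|].
    change (Re l = (Re l - Re (u 0%nat)) + Re (u 0%nat))%R; ring.
  - apply (is_series_incr_1 (fun n => Im (u n))).
    eapply eq_ind; [exact H2|].
    change (Im l = (Im l - Im (u 0%nat)) + Im (u 0%nat))%R; ring.
Qed.

Lemma is_series_geom_scal (M q : R) : (0 <= q < 1)%R ->
  is_series (fun n => M * q ^ n)%R (M / (1 - q))%R.
Proof.
  intros Hq; assert (H : (Rabs q < 1)%R) by (rewrite Rabs_pos_eq; lra).
  exact (is_series_scal_l M _ _ (is_series_geom q H)).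
Qed.

Lemma ex_series_Rabs_of_majorant (u : nat -> R) (M q : R) : (0 <= q < 1)%R ->
  (forall n, (Rabs (u n) <= M * q ^ n)%R) -> ex_series (fun n => Rabs (u n)).
Proof.
  intros Hq Hu.
  apply (ex_series_le (K := R_AbsRing) (V := R_CompleteNormedModule)
           _ (fun n => M * q ^ n)%R).
  - intros n; change (Rabs (Rabs (u n)) <= M * q ^ n)%R.
    rewrite Rabs_Rabsolu; apply Hu.
  - eexists; apply is_series_geom_scal; exact Hq.
Qed.

Lemma Rabs_Series_of_majorant (u : nat -> R) (M q : R) : (0 <= q < 1)%R ->
  (forall n, (Rabs (u n) <= M * q ^ n)%R) -> (Rabs (Series u) <= M / (1 - q))%R.
Proof.
  intros Hq Hu.
  eapply Rle_trans; [apply Series_Rabs, (ex_series_Rabs_of_majorant u M q Hq Hu)|].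
  rewrite <- (is_series_unique _ _ (is_series_geom_scal M q Hq)).
  apply Series_le; [|eexists; apply is_series_geom_scal; exact Hq].
  intros n; split; [apply Rabs_pos|apply Hu].
Qed.

Lemma C_sums_geom (u : nat -> C) (M q : R) :
  (0 <= q < 1)%R -> (forall n, (Cmod (u n) <= M * q ^ n)%R) ->
  C_sums u (CSeries u) /\ (Cmod (CSeries u) <= 2 * (M / (1 - q)))%R.
Proof.
  intros Hq Hu.
  assert (HR : forall n, (Rabs (Re (u n)) <= M * q ^ n)%R)
    by (intros n; eapply Rle_trans; [apply re_le_Cmod|apply Hu]).
  assert (HI : forall n, (Rabs (Im (u n)) <= M * q ^ n)%R)
    by (intros n; eapply Rle_trans; [apply Im_le_Cmod|apply Hu]).
  split.
  - split; apply Series_correct, ex_series_Rabs;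
      eapply ex_series_Rabs_of_majorant; eassumption.
  - eapply Rle_trans; [apply Cmod_le_Re_Im|].
    replace (2 * (M / (1 - q)))%R with (M / (1 - q) + M / (1 - q))%R by ring.
    apply Rplus_le_compat; apply Rabs_Series_of_majorant; assumption.
Qed.

Lemma Csum_seq_components (f : nat -> C) (n : nat) :
  Csum (seq 0 (S n)) f
  = (sum_f_R0 (fun k => Re (f k)) n, sum_f_R0 (fun k => Im (f k)) n).
Proof.
  induction n as [|n IH].
  - unfold Csum; simpl; rewrite Cplus_0_r; destruct (f 0%nat); reflexivity.
  - rewrite seq_S, Csum_snoc, IH; reflexivity.
Qed.

Lemma C_sums_cauchy (u v : nat -> C) (l m : C) :
  C_sums u l -> C_sums v m ->
  ex_series (fun n => Rabs (Re (u n))) -> ex_series (fun n => Rabs (Im (u n))) ->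
  ex_series (fun n => Rabs (Re (v n))) -> ex_series (fun n => Rabs (Im (v n))) ->
  C_sums (cauchy_product u v) (l * m).
Proof.
  intros [H1 H2] [H3 H4] A1 A2 A3 A4; split.
  - eapply is_series_ext;
      [|exact (is_series_minus _ _ _ _ (is_series_mult _ _ _ _ H1 H3 A1 A3)
                (is_series_mult _ _ _ _ H2 H4 A2 A4))].
    intros n; unfold cauchy_product; rewrite Csum_seq_components; cbn [Re fst].
    symmetry; exact (minus_sum (fun k => Re (u k) * Re (v (n - k)%nat))%R
      (fun k => Im (u k) * Im (v (n - k)%nat))%R n).
  - eapply is_series_ext;
      [|exact (is_series_plus _ _ _ _ (is_series_mult _ _ _ _ H1 H4 A1 A4)
                (is_series_mult _ _ _ _ H2 H3 A2 A3))].
    intros n; unfold cauchy_product; rewrite Csum_seq_components; cbn [Im snd].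
    symmetry; exact (plus_sum (fun k => Re (u k) * Im (v (n - k)%nat))%R
      (fun k => Im (u k) * Re (v (n - k)%nat))%R n).
Qed.

Definition power_series (a : nat -> C) (z : C) : C :=
  CSeries (fun k => z ^ k * a k).

Lemma power_series_term_bound (a : nat -> C) (M r : R) (z : C) :
  (1 <= r)%R -> (forall n, (Cmod (a n) <= M * r ^ n)%R) ->
  forall n, (Cmod (z ^ n * a n) <= M * (Cmod z * r) ^ n)%R.
Proof.
  intros Hr Ha n; rewrite Cmod_mult, Cmod_pow, Rpow_mult_distr.
  replace (M * (Cmod z ^ n * r ^ n))%R with (Cmod z ^ n * (M * r ^ n))%R by ring.
  apply Rmult_le_compat_l; [apply pow_le, Cmod_ge_0|apply Ha].
Qed.

Lemma Cmod_mult_lt_1 (r : R) (z : C) : (1 <= r)%R -> (Cmod z < / r)%R ->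
  (0 <= Cmod z * r < 1)%R.
Proof.
  intros Hr Hz; assert (H := Cmod_ge_0 z); split; [nra|].
  apply Rmult_lt_compat_r with (r := r) in Hz; [|lra].
  rewrite Rinv_l in Hz; lra.
Qed.

Lemma power_series_sums (a : nat -> C) (M r : R) (z : C) :
  (1 <= r)%R -> (forall n, (Cmod (a n) <= M * r ^ n)%R) ->
  (Cmod z < / r)%R -> C_sums (fun k => z ^ k * a k) (power_series a z).
Proof.
  intros Hr Ha Hz.
  apply (C_sums_geom _ M (Cmod z * r)); [apply Cmod_mult_lt_1; assumption|].
  apply power_series_term_bound; assumption.
Qed.

Lemma power_series_0 (a : nat -> C) : power_series a 0 = a 0%nat.
Proof.
  assert (H : forall f : C -> R, f 0 = 0%R ->
    is_series (fun k => f (0 ^ k * a k)) (f (a 0%nat))).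
  { intros f Hf; apply (is_series_decr_1 (fun k => f (0 ^ k * a k))).
    assert (H0 : is_series (fun k => f (0 ^ S k * a (S k))) 0%R).
    { apply (is_series_ext (fun _ => 0%R)).
      - intros n; rewrite <- Hf at 1; f_equal; simpl; ring.
      - apply filterlim_ext with (fun _ => 0%R); [|apply filterlim_const].
        intros n; rewrite sum_n_const; symmetry; apply Rmult_0_r. }
    eapply eq_ind; [exact H0|].
    replace (0 ^ 0 * a 0%nat) with (a 0%nat) by (simpl; ring).
    change (0 = f (a 0%nat) + - f (a 0%nat))%R; ring. }
  apply C_sums_unique; split; apply H; reflexivity.
Qed.

Lemma geom_bounded_coef (a : nat -> C) : geom_bounded a ->
  exists M r : R, (0 <= M)%R /\ (1 <= r)%R /\ forall n, (Cmod (a n) <= M * r ^ n)%R.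
Proof.
  intros [M [r [Hr Ha]]]; exists M, r; split; [|split; assumption].
  assert (H := Ha 0%nat); assert (H0 := Cmod_ge_0 (a 0%nat)); simpl in H; lra.
Qed.

Lemma power_series_cauchy (a b : nat -> C) : geom_bounded a -> geom_bounded b ->
  exists d : R, (0 < d)%R /\ forall z, (Cmod z < d)%R ->
    power_series (cauchy_product a b) z = power_series a z * power_series b z.
Proof.
  intros [M [r [Hr Ha]]] [N [s [Hs Hb]]].
  exists (Rmin (/ r) (/ s)); split.
  { apply Rmin_pos; apply Rinv_0_lt_compat; lra. }
  intros z Hz.
  assert (Hzr : (Cmod z < / r)%R) by (eapply Rlt_le_trans; [exact Hz|apply Rmin_l]).
  assert (Hzs : (Cmod z < / s)%R) by (eapply Rlt_le_trans; [exact Hz|apply Rmin_r]).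
  assert (Ba := power_series_term_bound a M r z Hr Ha).
  assert (Bb := power_series_term_bound b N s z Hs Hb).
  apply C_sums_unique.
  apply C_sums_ext with (cauchy_product (fun k => z ^ k * a k) (fun k => z ^ k * b k)).
  - intros n; unfold cauchy_product; rewrite <- Csum_scal; apply Csum_ext; intros k Hk.
    apply in_seq in Hk.
    replace (z ^ n) with (z ^ k * z ^ (n - k))
      by (rewrite <- Cpow_add_r; f_equal; lia).
    ring.
  - apply C_sums_cauchy.
    1: exact (power_series_sums a M r z Hr Ha Hzr).
    1: exact (power_series_sums b N s z Hs Hb Hzs).
    1,2: eapply ex_series_Rabs_of_majorant;
      [apply (Cmod_mult_lt_1 r z Hr Hzr)|]; intros n;
      (eapply Rle_trans; [|apply Ba]); [apply re_le_Cmod || apply Im_le_Cmod].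
    1,2: eapply ex_series_Rabs_of_majorant;
      [apply (Cmod_mult_lt_1 s z Hs Hzs)|]; intros n;
      (eapply Rle_trans; [|apply Bb]); [apply re_le_Cmod || apply Im_le_Cmod].
Qed.

(** * Complex differentiability *)

(** Complex differentiability with the modulus as the only norm, whereas the
    topology of C in [is_derive] comes from the product structure. *)
Definition C_diff_at (f : C -> C) (z l : C) : Prop :=
  forall eps : R, (0 < eps)%R -> exists d : R, (0 < d)%R /\
    forall w, (Cmod (w - z) < d)%R ->
      (Cmod (f w - f z - (w - z) * l) <= eps * Cmod (w - z))%R.

Lemma C_diff_at_is_derive (f : C -> C) (z l : C) :
  C_diff_at f z l -> @is_derive C_AbsRing C_NormedModule f z l.
Proof.
  intros H; split; [apply (@is_linear_scal_l C_AbsRing C_NormedModule)|].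
  intros x Hx; apply (@is_filter_lim_locally_unique C_AbsRing) in Hx; subst x.
  intros eps; destruct (H eps (cond_pos eps)) as [d [Hd Hf]].
  exists (mkposreal d Hd); intros w Hw; exact (Hf w Hw).
Qed.

Lemma is_derive_C_diff_at (f : C -> C) (z l : C) :
  @is_derive C_AbsRing C_NormedModule f z l -> C_diff_at f z l.
Proof.
  intros [_ H] eps Heps.
  destruct (H z (fun P HP => HP) (mkposreal eps Heps)) as [d Hd].
  exists d; split; [apply cond_pos|]; intros w Hw; exact (Hd w Hw).
Qed.

Lemma C_diff_at_unique (f : C -> C) (z l m : C) :
  C_diff_at f z l -> C_diff_at f z m -> l = m.
Proof.
  intros H1 H2; apply C_diff_at_is_derive, is_C_derive_unique in H1, H2.
  rewrite <- H1; exact H2.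
Qed.

Lemma C_locally_iff (z : C) (P : C -> Prop) :
  @locally C_UniformSpace z P <->
  exists d : R, (0 < d)%R /\ forall w, (Cmod (w - z) < d)%R -> P w.
Proof.
  rewrite locally_C; split.
  - intros [d Hd]; exists d; split; [apply cond_pos|exact Hd].
  - intros [d [Hd H]]; exists (mkposreal d Hd); exact H.
Qed.

Lemma C_diff_at_ext (f g : C -> C) (z l : C) :
  @locally C_UniformSpace z (fun w => f w = g w) ->
  C_diff_at f z l -> C_diff_at g z l.
Proof.
  intros H Hf eps Heps; apply C_locally_iff in H as [d1 [Hd1 H1]].
  destruct (Hf eps Heps) as [d2 [Hd2 H2]].
  exists (Rmin d1 d2); split; [apply Rmin_pos; assumption|]; intros w Hw.
  rewrite <- (H1 w), <- (H1 z).
  - apply H2; eapply Rlt_le_trans; [exact Hw|apply Rmin_r].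
  - replace (z - z) with (RtoC 0) by ring; rewrite Cmod_0; exact Hd1.
  - eapply Rlt_le_trans; [exact Hw|apply Rmin_l].
Qed.

Lemma C_diff_at_id (z : C) : C_diff_at (fun w => w) z 1.
Proof.
  intros eps Heps; exists 1%R; split; [lra|]; intros w _.
  replace (w - z - (w - z) * 1) with (RtoC 0) by ring.
  rewrite Cmod_0; apply Rmult_le_pos; [lra|apply Cmod_ge_0].
Qed.

Lemma C_diff_at_minus (f g : C -> C) (z l m : C) :
  C_diff_at f z l -> C_diff_at g z m -> C_diff_at (fun w => f w - g w) z (l - m).
Proof.
  intros Hf Hg eps Heps.
  destruct (Hf (eps / 2)%R ltac:(lra)) as [d1 [Hd1 H1]].
  destruct (Hg (eps / 2)%R ltac:(lra)) as [d2 [Hd2 H2]].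
  exists (Rmin d1 d2); split; [apply Rmin_pos; assumption|]; intros w Hw.
  replace (f w - g w - (f z - g z) - (w - z) * (l - m))
    with ((f w - f z - (w - z) * l) + - (g w - g z - (w - z) * m)) by ring.
  eapply Rle_trans; [apply Cmod_triangle|]; rewrite Cmod_opp.
  specialize (H1 w ltac:(eapply Rlt_le_trans; [exact Hw|apply Rmin_l])).
  specialize (H2 w ltac:(eapply Rlt_le_trans; [exact Hw|apply Rmin_r])).
  lra.
Qed.

Lemma C_diff_at_lipschitz (f : C -> C) (z l : C) : C_diff_at f z l ->
  exists d : R, (0 < d)%R /\ forall w, (Cmod (w - z) < d)%R ->
    (Cmod (f w - f z) <= (Cmod l + 1) * Cmod (w - z))%R.
Proof.
  intros H; destruct (H 1%R ltac:(lra)) as [d [Hd H1]].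
  exists d; split; [exact Hd|]; intros w Hw; specialize (H1 w Hw).
  replace (f w - f z) with ((f w - f z - (w - z) * l) + (w - z) * l) by ring.
  eapply Rle_trans; [apply Cmod_triangle|]; rewrite Cmod_mult; lra.
Qed.

Lemma C_diff_at_comp (f g : C -> C) (z l m : C) :
  C_diff_at f (g z) m -> C_diff_at g z l ->
  C_diff_at (fun w => f (g w)) z (l * m).
Proof.
  intros Hf Hg eps Heps.
  destruct (C_diff_at_lipschitz g z l Hg) as [d1 [Hd1 H1]].
  assert (Hl := Cmod_ge_0 l); assert (Hm := Cmod_ge_0 m).
  set (e := (eps / (Cmod l + 1 + Cmod m))%R).
  assert (He : (0 < e)%R) by (apply Rdiv_lt_0_compat; lra).
  destruct (Hf e He) as [d2 [Hd2 H2]].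
  destruct (Hg e He) as [d3 [Hd3 H3]].
  exists (Rmin (Rmin d1 d3) (d2 / (Cmod l + 1))); split.
  { repeat apply Rmin_pos; try assumption; apply Rdiv_lt_0_compat; lra. }
  intros w Hw.
  assert (Hw1 : (Cmod (w - z) < Rmin d1 d3)%R)
    by (eapply Rlt_le_trans; [exact Hw|apply Rmin_l]).
  assert (Hw2 : (Cmod (w - z) < d2 / (Cmod l + 1))%R)
    by (eapply Rlt_le_trans; [exact Hw|apply Rmin_r]).
  specialize (H1 w ltac:(eapply Rlt_le_trans; [exact Hw1|apply Rmin_l])).
  specialize (H3 w ltac:(eapply Rlt_le_trans; [exact Hw1|apply Rmin_r])).
  assert (Hg2 : (Cmod (g w - g z) < d2)%R).
  { eapply Rle_lt_trans; [exact H1|].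
    apply Rlt_div_r in Hw2; [|lra]. rewrite Rmult_comm; exact Hw2. }
  specialize (H2 (g w) Hg2).
  replace (f (g w) - f (g z) - (w - z) * (l * m))
    with ((f (g w) - f (g z) - (g w - g z) * m)
          + (g w - g z - (w - z) * l) * m) by ring.
  eapply Rle_trans; [apply Cmod_triangle|]; rewrite Cmod_mult.
  set (h := Cmod (w - z)) in *.
  apply Rle_trans with (e * ((Cmod l + 1) * h) + e * h * Cmod m)%R.
  - apply Rplus_le_compat.
    + eapply Rle_trans; [exact H2|]; apply Rmult_le_compat_l; [lra|exact H1].
    + apply Rmult_le_compat_r; [exact Hm|exact H3].
  - right; unfold e; field; lra.
Qed.

(** On the segment from 0 to z, the real and imaginary parts of the function
    are real functions with zero derivative. *)
Lemma C_diff_at_0_constant (f : C -> C) (d : R) :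
  (forall z, (Cmod z < d)%R -> C_diff_at f z 0) ->
  forall z, (Cmod z < d)%R -> f z = f 0.
Proof.
  intros H z Hz.
  assert (Hp : forall p : C -> R, (forall u v : C, p (u - v)%C = p u - p v)%R ->
    (forall u, Rabs (p u) <= Cmod u)%R -> p (f z) = p (f 0)).
  { intros p Hpm Hpb.
    assert (Hb := bounded_variation (fun t => p (f (t * z))) (fun _ => 0%R) 0 0 1).
    cbv beta in Hb; rewrite Cmult_1_l, Cmult_0_l in Hb.
    enough (Hd : (Rabs (p (f z) - p (f 0)) <= 0)%R).
    { assert (H0 := Rabs_pos (p (f z) - p (f 0))).
      apply Rminus_diag_uniq.
      destruct (Req_dec (p (f z) - p (f 0)) 0) as [E | E]; [exact E|].
      apply Rabs_pos_lt in E; lra. }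
    rewrite Rmult_0_l in Hb.
    apply Hb; intros t Ht; split; [|rewrite Rabs_R0; lra].
    apply is_derive_Reals; intros eps Heps.
    assert (Htz : (Cmod (t * z) < d)%R).
    { rewrite Cmod_mult, Cmod_R.
      rewrite !Rminus_0_r, Rabs_R1 in Ht.
      assert (Hz0 := Cmod_ge_0 z); nra. }
    assert (HC := Cmod_ge_0 z).
    destruct (H _ Htz (eps / (2 * (Cmod z + 1)))%R) as [r [Hr H1]].
    { apply Rdiv_lt_0_compat; lra. }
    assert (Hr' : (0 < r / (Cmod z + 1))%R) by (apply Rdiv_lt_0_compat; lra).
    exists (mkposreal _ Hr'); simpl; intros s Hs Hs'.
    replace (RtoC (t + s)) with (t + s) by (rewrite RtoC_plus; reflexivity).
    assert (Hdiff : (t + s) * z - t * z = s * z) by ring.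
    assert (Hs0 := Rabs_pos_lt s Hs).
    assert (Hsz : (Cmod ((t + s) * z - t * z) < r)%R).
    { rewrite Hdiff, Cmod_mult, Cmod_R.
      apply Rlt_div_r in Hs'; [|lra]. nra. }
    specialize (H1 _ Hsz).
    rewrite Hdiff, Cmult_0_r, Cmod_mult, Cmod_R in H1.
    replace (f ((t + s) * z) - f (t * z) - 0) with (f ((t + s) * z) - f (t * z)) in H1
      by ring.
    rewrite Rminus_0_r, <- Hpm, Rabs_div by exact Hs.
    apply Rlt_div_l; [exact Hs0|].
    eapply Rle_lt_trans; [apply Hpb|].
    eapply Rle_lt_trans; [exact H1|].
    apply Rlt_le_trans with (eps * Rabs s)%R; [|lra].
    apply Rle_lt_trans with (eps / 2 * Rabs s)%R; [|nra].
    replace (eps / (2 * (Cmod z + 1)) * (Rabs s * Cmod z))%R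
      with (eps / 2 * Rabs s * (Cmod z / (Cmod z + 1)))%R by (field; lra).
    rewrite <- (Rmult_1_r (eps / 2 * Rabs s)) at 2.
    apply Rmult_le_compat_l; [nra|].
    apply Rle_div_l; lra. }
  assert (HR := Hp Re ltac:(reflexivity) re_le_Cmod).
  assert (HI := Hp Im ltac:(reflexivity) Im_le_Cmod).
  destruct (f z), (f 0); simpl in HR, HI; subst; reflexivity.
Qed.

(** * Exponential and logarithm *)

Lemma derivable_pt_lim_remainder (f : R -> R) (x l eps : R) :
  derivable_pt_lim f x l -> (0 < eps)%R ->
  exists d : R, (0 < d)%R /\ forall h, (Rabs h < d)%R ->
    (Rabs (f (x + h) - f x - l * h) <= eps * Rabs h)%R.
Proof.
  intros H Heps; destruct (H eps Heps) as [d Hd].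
  exists d; split; [apply cond_pos|]; intros h Hh.
  destruct (Req_dec h 0) as [-> | Hne].
  - rewrite Rplus_0_r, Rabs_R0.
    replace (f x - f x - l * 0)%R with 0%R by ring; rewrite Rabs_R0; lra.
  - specialize (Hd h Hne Hh).
    replace (f (x + h) - f x - l * h)%R
      with (((f (x + h) - f x) / h - l) * h)%R by (field; exact Hne).
    rewrite Rabs_mult; apply Rmult_le_compat_r; [apply Rabs_pos|lra].
Qed.

Lemma Cexp_plus (z w : C) : Cexp (z + w) = Cexp z * Cexp w.
Proof.
  unfold Cexp; rewrite re_plus, im_plus, exp_plus, cos_plus, sin_plus.
  unfold Cmult; cbn [fst snd]; f_equal; ring.
Qed.

Lemma Cexp_remainder_0 (eps : R) : (0 < eps)%R ->
  exists d : R, (0 < d)%R /\ forall h, (Cmod h < d)%R ->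
    (Cmod (Cexp h - 1 - h) <= eps * Cmod h)%R.
Proof.
  (* With first-order remainders at most e and |h| < e <= 1, the two components
     of the error are at most 4 e |h| and 5 e |h|. *)
  intros Heps; set (e := Rmin 1 (eps / 9)).
  assert (He : (0 < e)%R) by (apply Rmin_pos; lra).
  assert (He1 : (e <= 1)%R) by apply Rmin_l.
  assert (He2 : (9 * e <= eps)%R).
  { assert (e <= eps / 9)%R by apply Rmin_r; lra. }
  destruct (derivable_pt_lim_remainder _ _ _ e derivable_pt_lim_exp_0 He)
    as [d1 [Hd1 H1]].
  destruct (derivable_pt_lim_remainder _ _ _ e (derivable_pt_lim_sin 0) He)
    as [d2 [Hd2 H2]].
  destruct (derivable_pt_lim_remainder _ _ _ e (derivable_pt_lim_cos 0) He)
    as [d3 [Hd3 H3]].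
  exists (Rmin (Rmin d1 d2) (Rmin d3 e)); split.
  { apply Rmin_pos; apply Rmin_pos; assumption. }
  intros h Hh.
  apply Rmin_Rgt_l in Hh as [Hh1 Hh2].
  apply Rmin_Rgt_l in Hh1 as [Hh1 Hh3]; apply Rmin_Rgt_l in Hh2 as [Hh2 Hh4].
  assert (Hx := re_le_Cmod h); assert (Hy := Im_le_Cmod h).
  specialize (H1 (Re h) ltac:(lra)).
  specialize (H2 (Im h) ltac:(lra)); specialize (H3 (Im h) ltac:(lra)).
  rewrite Rplus_0_l in H1, H2, H3.
  rewrite exp_0 in H1; rewrite sin_0, cos_0 in H2, H3.
  set (x := Re h) in *; set (y := Im h) in *.
  set (X := exp x) in *; set (s := sin y) in *; set (c := cos y) in *.
  eapply Rle_trans; [apply Cmod_le_Re_Im|].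
  replace (Re (Cexp h - 1 - h)) with ((X - 1 - 1 * x) + X * (c - 1 - - 0 * y))%R
    by (unfold Cminus; rewrite !re_plus, !re_opp, re_RtoC;
        change (Re (Cexp h)) with (X * c)%R; change (Re h) with x; ring).
  replace (Im (Cexp h - 1 - h)) with ((s - 0 - 1 * y) + (X - 1) * s)%R
    by (unfold Cminus; rewrite !im_plus, !im_opp, im_RtoC;
        change (Im (Cexp h)) with (X * s)%R; change (Im h) with y; ring).
  assert (Hx0 := Rabs_pos x); assert (Hy0 := Rabs_pos y).
  assert (HX : (Rabs (X - 1) <= 2 * Rabs x)%R).
  { replace (X - 1)%R with ((X - 1 - 1 * x) + x)%R by ring.
    eapply Rle_trans; [apply Rabs_triang|]; nra. }
  assert (HX3 : (Rabs X <= 3)%R).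
  { replace X with ((X - 1) + 1)%R by ring.
    eapply Rle_trans; [apply Rabs_triang|]; rewrite Rabs_R1; lra. }
  assert (Hs : (Rabs s <= 2 * Rabs y)%R).
  { replace s with ((s - 0 - 1 * y) + y)%R by ring.
    eapply Rle_trans; [apply Rabs_triang|]; nra. }
  assert (HA : (Rabs (X - 1 - 1 * x + X * (c - 1 - - 0 * y))
                <= e * Rabs x + 3 * (e * Rabs y))%R).
  { eapply Rle_trans; [apply Rabs_triang|]; rewrite Rabs_mult.
    apply Rplus_le_compat; [exact H1|].
    apply Rmult_le_compat; [apply Rabs_pos|apply Rabs_pos|exact HX3|exact H3]. }
  assert (HB : (Rabs (s - 0 - 1 * y + (X - 1) * s)
                <= e * Rabs y + 2 * Rabs x * (2 * Rabs y))%R).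
  { eapply Rle_trans; [apply Rabs_triang|]; rewrite Rabs_mult.
    apply Rplus_le_compat; [exact H2|].
    apply Rmult_le_compat; [apply Rabs_pos|apply Rabs_pos|exact HX|exact Hs]. }
  set (m := Cmod h) in *.
  assert (Rabs x * Rabs y <= e * m)%R by (apply Rmult_le_compat; lra).
  assert (e * Rabs x <= e * m)%R by (apply Rmult_le_compat_l; lra).
  assert (e * Rabs y <= e * m)%R by (apply Rmult_le_compat_l; lra).
  nra.
Qed.

Lemma C_diff_at_Cexp (z : C) : C_diff_at Cexp z (Cexp z).
Proof.
  intros eps Heps.
  assert (HE : (0 < Cmod (Cexp z))%R) by (rewrite Cmod_Cexp; apply exp_pos).
  destruct (Cexp_remainder_0 (eps / Cmod (Cexp z))) as [d [Hd H]].
  { apply Rdiv_lt_0_compat; assumption. }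
  exists d; split; [exact Hd|]; intros w Hw; specialize (H (w - z) Hw).
  replace (Cexp w) with (Cexp z * Cexp (w - z)) by (rewrite <- Cexp_plus; f_equal; ring).
  replace (Cexp z * Cexp (w - z) - Cexp z - (w - z) * Cexp z)
    with (Cexp z * (Cexp (w - z) - 1 - (w - z))) by ring.
  rewrite Cmod_mult.
  eapply Rle_trans; [apply Rmult_le_compat_l; [lra|exact H]|].
  right; field; lra.
Qed.

Lemma Cexp_neq_0 (z : C) : Cexp z <> 0.
Proof. apply Cmod_gt_0; rewrite Cmod_Cexp; apply exp_pos. Qed.

(** Differentiating exp (L w) = w gives w L'(w) = 1. *)
Lemma log_branch_diff (L : C -> C) (w0 : C) : is_log_branch_near L w0 ->
  exists d : R, (0 < d)%R /\ forall w, (Cmod (w - w0) < d)%R ->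
    w <> 0 /\ C_diff_at L w (/ w).
Proof.
  intros H; apply C_locally_iff in H as [d [Hd H]].
  exists d; split; [exact Hd|]; intros w Hw.
  destruct (H w Hw) as [[l Hl] HE].
  assert (Hw0 : w <> 0) by (rewrite <- HE; apply Cexp_neq_0).
  split; [exact Hw0|].
  apply is_derive_C_diff_at in Hl.
  assert (H1 := C_diff_at_comp _ _ _ _ _ (C_diff_at_Cexp (L w)) Hl).
  rewrite HE in H1.
  assert (H2 : C_diff_at (fun v => v) w (l * w)).
  { apply (C_diff_at_ext (fun v => Cexp (L v))); [|exact H1].
    apply C_locally_iff; exists (d - Cmod (w - w0))%R; split; [lra|].
    intros v Hv; apply H.
    replace (v - w0) with ((v - w) + (w - w0)) by ring.
    eapply Rle_lt_trans; [apply Cmod_triangle|lra]. }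
  assert (H3 := C_diff_at_unique _ _ _ _ H2 (C_diff_at_id w)).
  assert (Hinv : forall m : C, m * w = 1 -> m = / w).
  { intros m Hm; rewrite <- (Cmult_1_l (/ w)), <- Hm; field; exact Hw0. }
  rewrite <- (Hinv l H3); exact Hl.
Qed.

(** * Power series are their own Taylor series *)

Definition derived (a : nat -> C) (n : nat) : C := INR (S n) * a (S n).

Lemma INR_le_pow2 (n : nat) : (INR n <= 2 ^ n)%R.
Proof.
  induction n as [|n IH]; [simpl; lra|].
  rewrite S_INR; simpl.
  assert (H : (1 <= 2 ^ n)%R) by (apply pow_R1_Rle; lra). lra.
Qed.

Lemma derived_bound (a : nat -> C) (M r : R) :
  (0 <= M)%R -> (1 <= r)%R -> (forall n, (Cmod (a n) <= M * r ^ n)%R) ->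
  forall n, (Cmod (derived a n) <= 2 * M * r * (2 * r) ^ n)%R.
Proof.
  intros HM Hr Ha n; unfold derived; rewrite Cmod_mult, Cmod_R.
  rewrite Rabs_pos_eq by apply pos_INR.
  replace (2 * M * r * (2 * r) ^ n)%R with (2 ^ S n * (M * r ^ S n))%R
    by (rewrite Rpow_mult_distr; simpl; ring).
  apply Rmult_le_compat; [apply pos_INR|apply Cmod_ge_0|apply INR_le_pow2|apply Ha].
Qed.

Lemma derived_geom_bounded (a : nat -> C) : geom_bounded a -> geom_bounded (derived a).
Proof.
  intros H; destruct (geom_bounded_coef a H) as [M [r [HM [Hr Ha]]]].
  exists (2 * M * r)%R, (2 * r)%R; split; [lra|].
  apply derived_bound; assumption.
Qed.

(** The remainders R(n) on the left satisfy
    R(n+1) = w R(n) + (n+1) z^n (w-z)^2. *)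
Lemma Cpow_taylor_bound (w z : C) (p : R) (n : nat) :
  (0 < p)%R -> (Cmod w <= p)%R -> (Cmod z <= p)%R ->
  (p * p * Cmod (w ^ S n - z ^ S n - (w - z) * (INR (S n) * z ^ n))
   <= (2 * p) ^ S n * (Cmod (w - z) * Cmod (w - z)))%R.
Proof.
  intros Hp Hw Hz; set (h := Cmod (w - z)).
  assert (Hh : (0 <= h)%R) by apply Cmod_ge_0.
  induction n as [|n IH].
  - replace (w ^ 1 - z ^ 1 - (w - z) * (INR 1 * z ^ 0)) with (RtoC 0)
      by (simpl; ring).
    rewrite Cmod_0, Rmult_0_r; simpl; nra.
  - set (E := w ^ S n - z ^ S n - (w - z) * (INR (S n) * z ^ n)) in *.
    replace (w ^ S (S n) - z ^ S (S n) - (w - z) * (INR (S (S n)) * z ^ S n))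
      with (w * E + INR (S n) * z ^ n * ((w - z) * (w - z)))
      by (unfold E; rewrite (S_INR (S n)), RtoC_plus; simpl Cpow; ring).
    assert (H1 : (Cmod (w * E + INR (S n) * z ^ n * ((w - z) * (w - z)))
                  <= p * Cmod E + 2 ^ S n * p ^ n * (h * h))%R).
    { eapply Rle_trans; [apply Cmod_triangle|].
      rewrite !Cmod_mult, Cmod_R, Cmod_pow, Rabs_pos_eq by apply pos_INR; fold h.
      apply Rplus_le_compat.
      - apply Rmult_le_compat_r; [apply Cmod_ge_0|exact Hw].
      - apply Rmult_le_compat_r; [nra|].
        apply Rmult_le_compat; [apply pos_INR|apply pow_le, Cmod_ge_0
          |apply INR_le_pow2|apply pow_incr; split; [apply Cmod_ge_0|exact Hz]]. }
    apply Rle_trans with (p * p * (p * Cmod E + 2 ^ S n * p ^ n * (h * h)))%R.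
    { apply Rmult_le_compat_l; [nra|exact H1]. }
    replace ((2 * p) ^ S (S n) * (h * h))%R
      with (p * ((2 * p) ^ S n * (h * h)) + p * p * (2 ^ S n * p ^ n * (h * h)))%R
      by (rewrite !Rpow_mult_distr; simpl; ring).
    replace (p * p * (p * Cmod E + 2 ^ S n * p ^ n * (h * h)))%R
      with (p * (p * p * Cmod E) + p * p * (2 ^ S n * p ^ n * (h * h)))%R by ring.
    apply Rplus_le_compat_r, Rmult_le_compat_l; [lra|exact IH].
Qed.

(** On the disc of radius 1/(4r) the quadratic remainders of the powers sum to
    at most a constant times |w-z|^2. *)
Lemma power_series_diff (a : nat -> C) : geom_bounded a ->
  exists d : R, (0 < d)%R /\ forall z, (Cmod z < d)%R ->
    C_diff_at (power_series a) z (power_series (derived a) z).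
Proof.
  intros Hga; destruct (geom_bounded_coef a Hga) as [M [r [HM [Hr Ha]]]].
  set (p := (/ (4 * r))%R).
  assert (Hp : (0 < p)%R) by (apply Rinv_0_lt_compat; lra).
  assert (Hpr : (2 * p * r = / 2)%R) by (unfold p; field; lra).
  assert (Hp1 : (p < / r)%R) by (apply Rinv_lt_contravar; nra).
  assert (Hp2 : (p < / (2 * r))%R) by (apply Rinv_lt_contravar; nra).
  exists p; split; [exact Hp|]; intros z Hz eps Heps.
  set (K := (2 * M / (p * p))%R).
  assert (HK : (0 <= K)%R) by (apply Rdiv_le_0_compat; nra).
  exists (Rmin (p - Cmod z) (eps / (K + 1))); split.
  { apply Rmin_pos; [lra|apply Rdiv_lt_0_compat; lra]. }
  intros w Hw.
  assert (Hw1 : (Cmod (w - z) < p - Cmod z)%R)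
    by (eapply Rlt_le_trans; [exact Hw|apply Rmin_l]).
  assert (Hw2 : (Cmod (w - z) < eps / (K + 1))%R)
    by (eapply Rlt_le_trans; [exact Hw|apply Rmin_r]).
  assert (Hwp : (Cmod w < p)%R).
  { replace w with (z + (w - z)) by ring.
    eapply Rle_lt_trans; [apply Cmod_triangle|lra]. }
  set (h := Cmod (w - z)) in *.
  assert (Hh : (0 <= h)%R) by apply Cmod_ge_0.
  set (u := fun n : nat =>
    (w ^ S n - z ^ S n - (w - z) * (INR (S n) * z ^ n)) * a (S n)).
  assert (Hu : C_sums u (power_series a w - power_series a z
                         - (w - z) * power_series (derived a) z)).
  { assert (Sw := C_sums_tail _ _ (power_series_sums a M r w Hr Ha ltac:(lra))).
    assert (Sz := C_sums_tail _ _ (power_series_sums a M r z Hr Ha ltac:(lra))).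
    assert (Sd := C_sums_scal (w - z) _ _
      (power_series_sums (derived a) _ (2 * r) z ltac:(lra)
         (derived_bound a M r HM Hr Ha) ltac:(lra))).
    assert (S := C_sums_minus _ _ _ _ (C_sums_minus _ _ _ _ Sw Sz) Sd).
    replace (power_series a w - power_series a z
             - (w - z) * power_series (derived a) z)
      with (power_series a w - w ^ 0 * a 0%nat
            - (power_series a z - z ^ 0 * a 0%nat)
            - (w - z) * power_series (derived a) z) by (simpl; ring).
    eapply C_sums_ext; [|exact S].
    intros n; unfold u, derived; ring. }
  assert (Hub : forall n, (Cmod (u n) <= M * (h * h) / (p * p) / 2 * (/ 2) ^ n)%R).
  { intros n; unfold u; rewrite Cmod_mult.
    assert (HE := Cpow_taylor_bound w z p n Hp ltac:(lra) ltac:(lra)); fold h in HE.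
    set (E := Cmod (_ - _ - _)) in *.
    assert (HE0 : (0 <= E)%R) by apply Cmod_ge_0.
    apply Rle_trans with (((2 * p) ^ S n * (h * h) / (p * p)) * (M * r ^ S n))%R.
    - apply Rmult_le_compat; [exact HE0|apply Cmod_ge_0| |apply Ha].
      apply Rle_div_r; [nra|]. rewrite Rmult_comm; exact HE.
    - right.
      replace ((2 * p) ^ S n * (h * h) / (p * p) * (M * r ^ S n))%R
        with ((2 * p * r) ^ S n * (M * (h * h) / (p * p)))%R
        by (rewrite (Rpow_mult_distr (2 * p) r); field; lra).
      rewrite Hpr; simpl; field; lra. }
  destruct (C_sums_geom u _ (/ 2) ltac:(lra) Hub) as [_ Hb].
  rewrite (C_sums_unique _ _ Hu) in Hb.
  eapply Rle_trans; [exact Hb|].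
  replace (2 * (M * (h * h) / (p * p) / 2 / (1 - / 2)))%R with (K * h * h)%R
    by (unfold K; field; lra).
  apply Rmult_le_compat_r; [exact Hh|].
  apply Rle_trans with (K * (eps / (K + 1)))%R.
  - apply Rmult_le_compat_l; lra.
  - apply Rle_trans with ((K + 1) * (eps / (K + 1)))%R.
    + apply Rmult_le_compat_r; [|lra]. apply Rdiv_le_0_compat; lra.
    + right; field; lra.
Qed.

Lemma C_derive_n_power_series (f : C -> C) (c : nat -> C) :
  geom_bounded c ->
  @locally C_UniformSpace (RtoC 0) (fun z => f z = power_series c z) ->
  forall n, geom_bounded (Nat.iter n derived c) /\
    @locally C_UniformSpace (RtoC 0)
      (fun z => C_derive_n f n z = power_series (Nat.iter n derived c) z).
Proof.
  intros Hc Hf; induction n as [|n [IHg IH]]; [split; assumption|].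
  simpl Nat.iter; split; [apply derived_geom_bounded; exact IHg|].
  destruct (power_series_diff _ IHg) as [d1 [Hd1 H1]].
  apply locally_locally in IH; apply C_locally_iff in IH as [d2 [Hd2 H2]].
  apply C_locally_iff; exists (Rmin d1 d2); split; [apply Rmin_pos; assumption|].
  intros z Hz; apply Rmin_Rgt_l in Hz as [Hz1 Hz2].
  simpl; apply is_C_derive_unique, C_diff_at_is_derive.
  eapply C_diff_at_ext; [|apply H1].
  - specialize (H2 z Hz2); revert H2; apply filter_imp.
    intros w Hw; symmetry; exact Hw.
  - replace z with (z - 0) by ring; exact Hz1.
Qed.

Lemma iter_derived_fact (c : nat -> C) (n k : nat) :
  Nat.iter n derived c k * INR (fact k) = c (n + k)%nat * INR (fact (n + k)).
Proof.
  revert k; induction n as [|n IH]; intros k; [reflexivity|].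
  simpl Nat.iter; unfold derived at 1.
  transitivity (Nat.iter n derived c (S k) * INR (fact (S k))).
  - rewrite fact_simpl, mult_INR, RtoC_mult; ring.
  - rewrite IH; do 2 f_equal; [|do 2 f_equal]; lia.
Qed.

Lemma C_pow_n (z : C) (k : nat) : @pow_n C_Ring z k = z ^ k.
Proof. induction k as [|k IH]; [reflexivity|simpl; rewrite IH; reflexivity]. Qed.

Lemma sum_n_components (u : nat -> C) (n : nat) :
  @sum_n C_AbelianMonoid u n
  = (sum_n (fun k => Re (u k)) n, sum_n (fun k => Im (u k)) n).
Proof.
  induction n as [|n IH].
  - rewrite !sum_O; destruct (u 0%nat); reflexivity.
  - rewrite !sum_Sn, IH; reflexivity.
Qed.

Lemma C_sums_is_series (u : nat -> C) (l : C) :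
  C_sums u l -> @is_series C_AbsRing C_NormedModule u l.
Proof.
  intros [H1 H2].
  apply (proj2 (filterlim_locally (U := C_UniformSpace) _ _)); intros eps.
  assert (E1 := proj1 (filterlim_locally _ _) H1 eps).
  assert (E2 := proj1 (filterlim_locally _ _) H2 eps).
  generalize (filter_and _ _ E1 E2); apply filter_imp; intros n [B1 B2].
  change (@ball C_UniformSpace l eps (@sum_n C_AbelianMonoid u n)).
  rewrite sum_n_components; split; assumption.
Qed.

Lemma is_Taylor_series_power_series (f : C -> C) (c : nat -> C) :
  geom_bounded c ->
  @locally C_UniformSpace (RtoC 0) (fun z => f z = power_series c z) ->
  is_Taylor_series f 0 c.
Proof.
  intros Hc Hf; assert (HD := C_derive_n_power_series f c Hc Hf).
  split; [|split].
  - intros n; destruct (HD n) as [Hg Hn].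
    destruct (power_series_diff _ Hg) as [d1 [Hd1 H1]].
    apply locally_locally in Hn; apply C_locally_iff in Hn as [d2 [Hd2 H2]].
    apply C_locally_iff; exists (Rmin d1 d2); split; [apply Rmin_pos; assumption|].
    intros z Hz; apply Rmin_Rgt_l in Hz as [Hz1 Hz2].
    eexists; apply C_diff_at_is_derive.
    eapply C_diff_at_ext; [|apply H1].
    + specialize (H2 z Hz2); revert H2; apply filter_imp.
      intros w Hw; symmetry; exact Hw.
    + replace z with (z - 0) by ring; exact Hz1.
  - intros n; destruct (HD n) as [_ Hn]; apply locally_singleton in Hn.
    rewrite Hn, power_series_0.
    assert (H := iter_derived_fact c n 0); rewrite Nat.add_0_r in H.
    simpl fact in H; rewrite INR_1, Cmult_1_r in H; rewrite H.
    field; intros E; apply RtoC_inj in E; exact (INR_fact_neq_0 n E).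
  - destruct Hc as [M [r [Hr Hc]]].
    apply C_locally_iff in Hf as [d [Hd Hf]].
    apply C_locally_iff; exists (Rmin d (/ r)); split.
    { apply Rmin_pos; [exact Hd|apply Rinv_0_lt_compat; lra]. }
    intros z Hz; apply Rmin_Rgt_l in Hz as [Hz1 Hz2].
    rewrite Hf by exact Hz1.
    replace (z - 0) with z in * by ring.
    apply C_sums_is_series.
    eapply C_sums_ext; [|eapply power_series_sums; eassumption].
    intros k; rewrite <- C_pow_n; reflexivity.
Qed.

(** * The logarithm of a power series *)

Lemma Cmod_Csum_le {A : Type} (s : list A) (f : A -> C) :
  (Cmod (Csum s f) <= fold_right Rplus 0 (map (fun x => Cmod (f x)) s))%R.
Proof.
  induction s as [|x s IH]; [unfold Csum; simpl; rewrite Cmod_0; lra|].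
  rewrite Csum_cons; simpl; eapply Rle_trans; [apply Cmod_triangle|lra].
Qed.

Lemma geom_bounded_le (M M' r r' : R) (n : nat) :
  (0 <= M <= M')%R -> (1 <= r <= r')%R -> (M * r ^ n <= M' * r' ^ n)%R.
Proof.
  intros HM Hr; apply Rmult_le_compat; [lra|apply pow_le; lra|lra|].
  apply pow_incr; lra.
Qed.

(** Division of power series.  With |u(n)|, |(v u)(n)| <= M r^n and
    D = M / |u(0)|, the weighted partial sums of |v(j)| r^-j stay below
    (1 + D)^n - 1: the recursion for v(n) then gives
    |v(n)| <= D r^n (1 + D)^n, which is exactly the increment needed. *)
Lemma geom_bounded_cauchy_quotient (v u : nat -> C) :
  u 0%nat <> 0 -> geom_bounded u -> geom_bounded (cauchy_product v u) -> geom_bounded v.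
Proof.
  intros Hu0 Hu Hw.
  destruct (geom_bounded_coef _ Hu) as [M1 [r1 [HM1 [Hr1 B1]]]].
  destruct (geom_bounded_coef _ Hw) as [M2 [r2 [HM2 [Hr2 B2]]]].
  set (M := (M1 + M2)%R); set (r := (r1 + r2)%R).
  assert (Bu : forall n, (Cmod (u n) <= M * r ^ n)%R).
  { intros n; eapply Rle_trans; [apply B1|].
    apply geom_bounded_le; unfold M, r; lra. }
  assert (Bw : forall n, (Cmod (cauchy_product v u n) <= M * r ^ n)%R).
  { intros n; eapply Rle_trans; [apply B2|].
    apply geom_bounded_le; unfold M, r; lra. }
  assert (Hr : (1 <= r)%R) by (unfold r; lra).
  assert (HM : (0 <= M)%R) by (unfold M; lra).
  assert (Hg : (0 < Cmod (u 0%nat))%R) by (apply Cmod_gt_0; exact Hu0).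
  set (g := Cmod (u 0%nat)) in *; set (D := (M / g)%R).
  assert (HD : (0 <= D)%R) by (apply Rdiv_le_0_compat; assumption).
  (* T n is the sum of |v(j)| / r^j over j < n. *)
  set (T := fun n => fold_right Rplus 0%R (map (fun j => Cmod (v j) / r ^ j)%R (seq 0 n))).
  assert (HTS : forall n, T (S n) = (T n + Cmod (v n) / r ^ n)%R).
  { intros n; unfold T; rewrite seq_S, map_app, fold_right_app; simpl.
    generalize (map (fun j => Cmod (v j) / r ^ j)%R (seq 0 n)).
    induction l as [|x l IH]; simpl; [ring|rewrite IH; ring]. }
  assert (Hrn : forall n, (0 < r ^ n)%R) by (intros n; apply pow_lt; lra).
  assert (Hstep : forall n, (Cmod (v n) * g <= M * r ^ n * (1 + T n))%R).
  { intros n.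
    assert (E : v n * u 0%nat
      = cauchy_product v u n - Csum (seq 0 n) (fun j => v j * u (n - j)%nat)).
    { unfold cauchy_product; rewrite seq_S, Csum_snoc; cbn [Nat.add].
      rewrite Nat.sub_diag; ring. }
    unfold g; rewrite <- Cmod_mult, E; unfold Cminus.
    eapply Rle_trans; [apply Cmod_triangle|]; rewrite Cmod_opp.
    rewrite Rmult_plus_distr_l, Rmult_1_r; apply Rplus_le_compat; [apply Bw|].
    eapply Rle_trans; [apply Cmod_Csum_le|].
    assert (Hs : forall s, (forall j, In j s -> (j <= n)%nat) ->
      (fold_right Rplus 0 (map (fun j => Cmod (v j * u (n - j)%nat)) s)
       <= M * r ^ n * fold_right Rplus 0 (map (fun j => Cmod (v j) / r ^ j) s))%R).
    { induction s as [|j s IH]; intros Hj; simpl; [lra|].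
      rewrite Rmult_plus_distr_l; apply Rplus_le_compat.
      - rewrite Cmod_mult.
        replace (M * r ^ n * (Cmod (v j) / r ^ j))%R
          with (Cmod (v j) * (M * r ^ (n - j)))%R.
        + apply Rmult_le_compat_l; [apply Cmod_ge_0|apply Bu].
        + replace n with ((n - j) + j)%nat at 2
            by (specialize (Hj j (or_introl eq_refl)); lia).
          rewrite pow_add; field; apply Rgt_not_eq, Hrn.
      - apply IH; intros i Hi; apply Hj; right; exact Hi. }
    apply Hs; intros j Hj; apply in_seq in Hj; lia. }
  assert (Hv : forall n, (T n <= (1 + D) ^ n - 1)%R ->
                 (Cmod (v n) / r ^ n <= D * (1 + D) ^ n)%R).
  { intros n HT; apply Rle_div_l; [apply Hrn|].
    apply Rmult_le_reg_r with g; [exact Hg|].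
    eapply Rle_trans; [apply Hstep|].
    replace (D * (1 + D) ^ n * r ^ n * g)%R with (M * r ^ n * (1 + D) ^ n)%R
      by (unfold D; field; lra).
    apply Rmult_le_compat_l; [|lra].
    apply Rmult_le_pos; [exact HM|left; apply Hrn]. }
  assert (HT : forall n, (T n <= (1 + D) ^ n - 1)%R).
  { induction n as [|n IH]; [unfold T; simpl; lra|].
    rewrite HTS; specialize (Hv n IH); simpl; lra. }
  exists D, ((1 + D) * r)%R; split; [nra|]; intros n.
  specialize (Hv n (HT n)); apply (proj1 (Rle_div_l _ _ _ (Hrn n))) in Hv.
  rewrite Rpow_mult_distr, <- Rmult_assoc; exact Hv.
Qed.

(** The coefficients of log (sum of u), with w as the chosen value of
    log u(0). *)
Definition log_series (w : C) (u : nat -> C) (n : nat) : C :=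
  match n with O => w | S _ => log_coef (/ u 0%nat) u n end.

Lemma cauchy_derived_log_series (w : C) (u : nat -> C) (n : nat) :
  u 0%nat <> 0 -> cauchy_product (derived (log_series w u)) u n = derived u n.
Proof.
  intros Hu.
  assert (H := cauchy_euler_log_coef (/ u 0%nat) u (S n) (Cinv_l _ Hu)).
  rewrite cauchy_S in H; unfold euler at 1 in H; simpl (INR 0) in H.
  rewrite !Cmult_0_l, Cplus_0_l in H; exact H.
Qed.

Lemma log_series_geom_bounded (w : C) (u : nat -> C) :
  u 0%nat <> 0 -> geom_bounded u -> geom_bounded (log_series w u).
Proof.
  intros Hu0 Hu.
  assert (Hd : geom_bounded (derived (log_series w u))).
  { apply (geom_bounded_cauchy_quotient _ u Hu0 Hu).
    destruct (derived_geom_bounded u Hu) as [M [r [Hr H]]].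
    exists M, r; split; [exact Hr|]; intros n.
    rewrite cauchy_derived_log_series by exact Hu0; apply H. }
  destruct (geom_bounded_coef _ Hd) as [M [r [HM [Hr H]]]].
  apply (geom_bounded_eventually _ 1 M r Hr); intros [|n] Hn; [lia|].
  specialize (H n); unfold derived in H; rewrite Cmod_mult, Cmod_R in H.
  rewrite Rabs_pos_eq in H by apply pos_INR.
  assert (H1 : (1 <= INR (S n))%R) by (apply (le_INR 1); lia).
  assert (H2 := Cmod_ge_0 (log_series w u (S n))).
  apply Rle_trans with (M * r ^ n)%R; [nra|].
  apply Rmult_le_compat_l; [exact HM|]; simpl.
  assert (H3 : (0 < r ^ n)%R) by (apply pow_lt; lra). nra.
Qed.

(** Near 0 both sides have derivative f'/f, where f is the sum of u, and they
    agree at 0. *)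
Lemma log_power_series (u : nat -> C) (L : C -> C) :
  geom_bounded u -> is_log_branch_near L (u 0%nat) ->
  @locally C_UniformSpace (RtoC 0) (fun z =>
    L (power_series u z) = power_series (log_series (L (u 0%nat)) u) z).
Proof.
  intros Hu HL.
  destruct (log_branch_diff L _ HL) as [d0 [Hd0 H0]].
  assert (Hu0 : u 0%nat <> 0).
  { apply H0; replace (u 0%nat - u 0%nat) with (RtoC 0) by ring.
    rewrite Cmod_0; exact Hd0. }
  set (c := log_series (L (u 0%nat)) u).
  assert (Hc : geom_bounded c) by (apply log_series_geom_bounded; assumption).
  destruct (power_series_diff u Hu) as [d1 [Hd1 H1]].
  destruct (power_series_diff c Hc) as [d2 [Hd2 H2]].
  destruct (power_series_cauchy (derived c) u (derived_geom_bounded c Hc) Hu)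
    as [d3 [Hd3 H3]].
  destruct (C_diff_at_lipschitz _ _ _ (H1 0 ltac:(rewrite Cmod_0; exact Hd1)))
    as [d4 [Hd4 H4]].
  rewrite power_series_0 in H4.
  set (k := (Cmod (power_series (derived u) 0) + 1)%R) in *.
  assert (Hk : (0 < k)%R) by (unfold k; assert (H := Cmod_ge_0 (power_series (derived u) 0)); lra).
  set (d := Rmin (Rmin (Rmin d1 d2) (Rmin d3 d4)) (d0 / k)).
  assert (Hd : (0 < d)%R).
  { repeat apply Rmin_pos; try assumption; apply Rdiv_lt_0_compat; assumption. }
  apply C_locally_iff; exists d; split; [exact Hd|]; intros z0 Hz0.
  replace (z0 - 0) with z0 in Hz0 by ring.
  assert (Hdiff : forall z, (Cmod z < d)%R ->
    C_diff_at (fun z => L (power_series u z) - power_series c z) z 0).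
  { intros z Hz.
    apply Rmin_Rgt_l in Hz as [Hz Hz5]; apply Rmin_Rgt_l in Hz as [Hz Hz'].
    apply Rmin_Rgt_l in Hz as [Hz1 Hz2]; apply Rmin_Rgt_l in Hz' as [Hz3 Hz4].
    assert (Hball : (Cmod (power_series u z - u 0%nat) < d0)%R).
    { specialize (H4 z); replace (z - 0) with z in H4 by ring.
      eapply Rle_lt_trans; [apply H4; exact Hz4|].
      apply Rlt_div_r in Hz5; [|exact Hk]. lra. }
    destruct (H0 _ Hball) as [Hne HLd].
    assert (Hm : power_series (derived u) z
                 = power_series (derived c) z * power_series u z).
    { rewrite <- H3 by exact Hz3.
      unfold power_series at 1 2.
      assert (E : forall n, cauchy_product (derived c) u n = derived u n)
        by (intros n; apply cauchy_derived_log_series; exact Hu0).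
      unfold CSeries; f_equal; apply Series_ext; intros n; rewrite E; reflexivity. }
    replace (RtoC 0) with (power_series (derived u) z * / power_series u z
                           - power_series (derived c) z).
    - apply C_diff_at_minus; [|apply H2; exact Hz2].
      apply C_diff_at_comp; [exact HLd|apply H1; exact Hz1].
    - rewrite Hm; field; exact Hne. }
  assert (HE := C_diff_at_0_constant _ d Hdiff z0 Hz0); cbv beta in HE.
  rewrite !power_series_0 in HE.
  unfold c in HE at 2; simpl (log_series _ _ 0) in HE.
  apply Ceq_minus; rewrite HE; ring.
Qed.

Theorem mainTheorem4 (a b : C) (ha : (0 < Re a)%R)
    (hb : forall n : nat, b <> - INR n)
    (L : C -> C) (hL : is_log_branch_near L (rGamma b)) :
  is_Taylor_series (fun z => L (mittag_leffler a b z)) 0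
    (fun m => match m with
              | O => L (rGamma b)
              | S _ => log_ML_coef a b m
              end).
Proof.
  set (u := fun n : nat => rGamma (b + a * INR n)).
  assert (Hu0 : u 0%nat = rGamma b) by (unfold u; f_equal; simpl; ring).
  rewrite <- Hu0 in hL.
  assert (Hu : geom_bounded u) by (apply mittag_leffler_coef_geom_bounded; exact ha).
  assert (Hc : forall m, log_series (L (u 0%nat)) u m
    = match m with O => L (rGamma b) | S _ => log_ML_coef a b m end).
  { intros [|m]; [simpl; rewrite Hu0; reflexivity|].
    rewrite log_ML_coef_eq; simpl log_series; rewrite Hu0; reflexivity. }
  assert (Hloc := log_power_series u L Hu hL).
  apply is_Taylor_series_power_series.
  - assert (Hg : geom_bounded (log_series (L (u 0%nat)) u)).
    { apply log_series_geom_bounded; [|exact Hu].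
      apply locally_singleton in hL as [_ HE]; rewrite <- HE; apply Cexp_neq_0. }
    destruct Hg as [M [r [Hr H]]]; exists M, r; split; [exact Hr|].
    intros m; rewrite <- Hc; apply H.
  - revert Hloc; apply filter_imp; intros z Hz.
    change (mittag_leffler a b z) with (power_series u z); rewrite Hz.
    unfold power_series, CSeries; f_equal; apply Series_ext; intros m;
      rewrite Hc; reflexivity.
Qed.
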